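(* Let $y\in \mathbb{K}$. Define linear maps by giving their values on graphs $G\in\mathbf{G}$: $$\zeta_y:\mathcal{H}_{\mathbf{G}}\to\mathbb{K}[X],\ \zeta_y(G)=Z_G(X,y);\qquad \lambda_y:\mathcal{H}_{\mathbf{G}}\to\mathbb{K},\ \lambda_y(G)=\sum_{H\in \mathcal{C}(G)} y^{|E(H)|};\qquad \mu_y:\mathcal{H}_{\mathbf{G}}\to\mathbb{K},\ \mu_y(G)=(1+y)^{|E(G)|}.$$ Then $\zeta_y$ is a Hopf algebra morphism from $(\mathcal{H}_{\mathbf{G}},m,\Delta)$ to $(\mathbb{K}[X],m,\Delta)$, and $\lambda_y$ and $\mu_y$ are characters of $\mathcal{H}_{\mathbf{G}}$. Moreover, $$\zeta_y=\phi_0\leftsquigarrow \lambda_y=\phi_{chr}\leftsquigarrow \mu_y.$$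
   Context: $\mathbb{K}$ is a commutative field of characteristic $0$. Graphs are finite and simple: $G=(V(G),E(G))$ with $E(G)$ a set of unordered pairs of distinct vertices; the empty graph is allowed. $\mathbf{G}$ is the set of isoclasses of graphs and $\mathcal{H}_{\mathbf{G}}$ is the $\mathbb{K}$-vector space with basis $\mathbf{G}$. The product $m$ is disjoint union (unit: the empty graph $1$). For $I\subseteq V(G)$, $G_{\mid I}$ is the induced subgraph. The coproduct $\Delta$ is $\Delta(G)=\sum_{I\subseteq V(G)} G_{\mid I}\otimes G_{\mid V(G)\setminus I}$, with counit $\varepsilon_\Delta(G)=1$ if $G$ is empty, $0$ otherwise. $(\mathcal{H}_{\mathbf{G}},m,\Delta)$ is a Hopf algebra. For an equivalence relation $\sim$ on $V(G)$ with canonical surjection $\pi_\sim$, the contracted graph $G/\sim$ has vertex set $V(G)/\sim$ and edges $\{\pi_\sim(x),\pi_\sim(y)\}$ for $\{x,y\}\in E(G)$ with $\pi_\sim(x)\ne\pi_\sim(y)$; the restricted graph $G\mid\sim$ has vertex set $V(G)$ and edges those $\{x,y\}\in E(G)$ with $\pi_\sim(x)=\pi_\sim(y)$. $\mathcal{E}_c(G)$ is the set of equivalences $\sim$ on $V(G)$ such that $G_{\mid C}$ is connected for every class $C$. The second coproduct is $\delta(G)=\sum_{\sim\in\mathcal{E}_c(G)} G/\sim\,\otimes\, G\mid\sim$. $\mathbb{K}[X]$ is a Hopf algebra with its usual product and the multiplicative coproduct $\Delta(X)=X\otimes1+1\otimes X$. A character is a unital algebra morphism to $\mathbb{K}$.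 For a linear map $\phi:\mathcal{H}_{\mathbf{G}}\to\mathbb{K}[X]$ and a character $\lambda$ of $\mathcal{H}_{\mathbf{G}}$, $\phi\leftsquigarrow\lambda=(\phi\otimes\lambda)\circ\delta$ (identifying $\mathbb{K}[X]\otimes\mathbb{K}$ with $\mathbb{K}[X]$). $\phi_0$ is the linear map with $\phi_0(G)=X^{|V(G)|}$, and $\phi_{chr}$ is the linear map sending $G$ to its chromatic polynomial (the polynomial in $X$ whose value at each $k\in\mathbb{N}$ is the number of proper colorings $V(G)\to\{1,\ldots,k\}$). For $F\subseteq E(G)$, $G_{\mid F}$ is the graph with vertex set $V(G)$ and edge set $F$; $\mathrm{cc}$ denotes the number of connected components. The Fortuin-Kasteleyn polynomial is $Z_G(X,Y)=\sum_{F\subseteq E(G)} X^{\mathrm{cc}(G_{\mid F})}Y^{|F|}$. A covering graph of $G$ is a graph $H$ with $V(H)=V(G)$, $E(H)\subseteq E(G)$ and $\mathrm{cc}(H)=\mathrm{cc}(G)$; $\mathcal{C}(G)$ is the set of covering graphs of $G$. The convention $0^0=1$ is used. *)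

(* Defs.v *)
From HB Require Import structures.
From mathcomp Require mpoly.
From mathcomp Require Import monalg.
From mathcomp Require Import all_boot all_order all_algebra.
From mathcomp Require Import generic_quotient finmap.

Set Implicit Arguments.
Unset Strict Implicit.
Unset Printing Implicit Defensive.

Import GRing.Theory.
Local Open Scope ring_scope.
Local Open Scope quotient_scope.

Record sgraph := SGraph {
  vertex :> finType;
  edges : {set {set vertex}};
  card_edges : [forall e in edges, #|e| == 2]
}.

Definition adj (G : sgraph) : rel G := fun x y => [set x; y] \in edges G.
Arguments adj : clear implicits.

(* For F \subset edges G this is the graph written G_{|F}; intersecting with *)
(* edges G only makes the construction total.                               *)
Lemma spanning_card (G : sgraph) (F : {set {set G}}) :
  [forall e in F :&: edges G, #|e| == 2].
Proof.
apply/forall_inP => e; rewrite inE => /andP[_ eG].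
exact: (forall_inP (card_edges G)).
Qed.

Definition spanning (G : sgraph) (F : {set {set G}}) :=
  SGraph (spanning_card F).

Lemma induced_card (G : sgraph) (I : {set G}) :
  [forall e in [set e : {set {x | x \in I}} | val @: e \in edges G], #|e| == 2].
Proof.
apply/forall_inP => e; rewrite inE => /(forall_inP (card_edges G)).
by rewrite card_imset //; apply: val_inj.
Qed.

Definition induced (G : sgraph) (I : {set G}) := SGraph (induced_card I).

Definition gempty : sgraph.
Proof.
by apply: (@SGraph void set0); apply/forall_inP => e; rewrite inE.
Defined.

Lemma gunion_card (G H : sgraph) :
  [forall e in [set inl @: (e : {set G}) | e in edges G]
           :|: [set inr @: (e : {set H}) | e in edges H],
     #|(e : {set G + H})| == 2].
Proof.
apply/forall_inP => e; rewrite inE => /orP[] /imsetP[e' e'G ->];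
  rewrite card_imset; try by move=> ? ? [].
- exact: (forall_inP (card_edges G)).
- exact: (forall_inP (card_edges H)).
Qed.

Definition gunion (G H : sgraph) := SGraph (gunion_card G H).

(* The number of connected components of G. *)
Definition cc (G : sgraph) : nat := n_comp (adj G) predT.

(* The empty graph satisfies this; it is only applied to nonempty graphs. *)
Definition gconnected (G : sgraph) : bool :=
  [forall x : G, forall y : G, connect (adj G) x y].

(* Relations on V are encoded by their graphs, subsets of V * V. *)
Definition is_equivalence (V : finType) (r : {set V * V}) : bool :=
  [&& [forall x, (x, x) \in r],
      [forall x, forall y, ((x, y) \in r) ==> ((y, x) \in r)] &
      [forall x, forall y, forall z,
         ((x, y) \in r) && ((y, z) \in r) ==> ((x, z) \in r)]].

Definition eqclass (V : finType) (r : {set V * V}) (x : V) : {set V} :=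
  [set y | (x, y) \in r].

Definition quot (V : finType) (r : {set V * V}) : finType :=
  {B : {set V} | B \in [set eqclass r x | x : V]}.

Definition qpi (V : finType) (r : {set V * V}) (x : V) : quot r :=
  exist _ (eqclass r x) (imset_f (eqclass r) (erefl true)).

Lemma contract_card (G : sgraph) (r : {set G * G}) :
  [forall e in [set [set qpi r p.1; qpi r p.2] | p : G * G
                  & ([set p.1; p.2] \in edges G) && (qpi r p.1 != qpi r p.2)],
     #|e| == 2].
Proof.
apply/forall_inP => e /imsetP[p]; rewrite inE => /andP[_ np] ->.
by rewrite cards2 np.
Qed.

Definition contract (G : sgraph) (r : {set G * G}) :=
  SGraph (contract_card r).

Lemma restrict_card (G : sgraph) (r : {set G * G}) :
  [forall e in [set [set p.1; p.2] | p : G * G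
                  & ([set p.1; p.2] \in edges G) && (qpi r p.1 == qpi r p.2)],
     #|e| == 2].
Proof.
apply/forall_inP => e /imsetP[p]; rewrite inE => /andP[pG _] ->.
exact: (forall_inP (card_edges G)).
Qed.

Definition restrict (G : sgraph) (r : {set G * G}) :=
  SGraph (restrict_card r).

Definition Ec (G : sgraph) : {set {set G * G}} :=
  [set r | is_equivalence r
         & [forall x : G, gconnected (induced (eqclass r x))]].

Definition giso (G H : sgraph) : bool :=
  [exists f : {ffun G -> H},
     [&& injectiveb f, f @: [set: G] == [set: H]
       & edges H == [set f @: (e : {set G}) | e in edges G]]].

Section AdjTheory.

Lemma imset_pair (T U : finType) (f : T -> U) x y :
  f @: [set x; y] = [set f x; f y].
Proof. by rewrite imsetU !imset_set1. Qed.

Lemma adj_sym (G : sgraph) : symmetric (adj G).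
Proof. by move=> x y; rewrite /adj setUC. Qed.

Lemma adj_irr (G : sgraph) : irreflexive (adj G).
Proof.
move=> x; apply/negP => /(forall_inP (card_edges G)).
by rewrite setUid cards1.
Qed.

Lemma edgesP (G : sgraph) (e : {set G}) :
  reflect (exists x y, adj G x y /\ e = [set x; y]) (e \in edges G).
Proof.
apply: (iffP idP) => [eG|[x [y [xy ->]]]] //.
have /cards2P[x [y [nxy ee]]] := forall_inP (card_edges G) e eG.
by exists x, y; split; rewrite // /adj -ee.
Qed.

Lemma giso_of_adj (G H : sgraph) (f : G -> H) :
  bijective f -> (forall x y, adj H (f x) (f y) = adj G x y) -> giso G H.
Proof.
move=> [g fK gK] fa; apply/existsP; exists [ffun x => f x]; apply/and3P; split.
- by apply/injectiveP => x y; rewrite !ffunE => /(can_inj fK).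
- apply/eqP/setP => z; rewrite inE; apply/imsetP; exists (g z) => //.
  by rewrite ffunE gK.
- apply/eqP/setP => e; apply/edgesP/imsetP => [[x [y [xy ->]]]|[e' + ->]].
    exists [set g x; g y]; first by have := fa (g x) (g y); rewrite !gK xy => /esym.
    by rewrite imset_pair !ffunE !gK.
  move=> /edgesP[x [y [xy ->]]]; exists (f x), (f y); rewrite fa; split=> //.
  by rewrite imset_pair !ffunE.
Qed.

Lemma giso_adj (G H : sgraph) : giso G H ->
  exists2 f : G -> H, bijective f & forall x y, adj H (f x) (f y) = adj G x y.
Proof.
case/existsP => f /and3P[/injectiveP fi /eqP fs /eqP eH]; exists f.
  have cardGH : (#|H| <= #|G|)%N by rewrite -!cardsT -fs leq_imset_card.
  exact: inj_card_bij.
move=> x y; rewrite /adj eH -imset_pair mem_imset //.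
exact: imset_inj.
Qed.

Lemma giso_refl : reflexive giso.
Proof. by move=> G; apply: (@giso_of_adj G G id) => //; exists id. Qed.

Lemma giso_sym : symmetric giso.
Proof.
suff imp G H : giso G H -> giso H G by move=> G H; apply/idP/idP; apply: imp.
case/giso_adj => f [g fK gK] fa; apply: (@giso_of_adj _ _ g); first by exists f.
by move=> x y; rewrite -fa !gK.
Qed.

Lemma giso_trans : transitive giso.
Proof.
move=> H G L /giso_adj[f fb fa] /giso_adj[g gb ga].
apply: (@giso_of_adj _ _ (g \o f)); first exact: bij_comp.
by move=> x y; rewrite /= ga fa.
Qed.

End AdjTheory.

(* Isoclasses: graphs on the sets 'I_n, up to isomorphism. *)
Definition edge_set (n : nat) :=
  {E : {set {set 'I_n}} | [forall e in E, #|e| == 2]}.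
Definition ograph := {n : nat & edge_set n}.

Definition graph_of (g : ograph) : sgraph := SGraph (valP (tagged g)).

Definition ograph_iso : rel ograph := fun g h => giso (graph_of g) (graph_of h).

Lemma ograph_iso_refl : reflexive ograph_iso.
Proof. by move=> g; apply: giso_refl. Qed.

Lemma ograph_iso_sym : symmetric ograph_iso.
Proof. by move=> g h; apply: giso_sym. Qed.

Lemma ograph_iso_trans : transitive ograph_iso.
Proof. by move=> g h k; apply: giso_trans. Qed.

Canonical ograph_iso_equiv :=
  EquivRel ograph_iso ograph_iso_refl ograph_iso_sym ograph_iso_trans.

Definition isoclass := {eq_quot ograph_iso}.
HB.instance Definition _ := Choice.on isoclass.
HB.instance Definition _ := Quotient.on isoclass.

Lemma ograph_of_card (G : sgraph) :
  [forall e in [set enum_rank @: (e : {set G}) | e in edges G], #|e| == 2].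
Proof.
apply/forall_inP => e /imsetP[e' e'G ->].
rewrite card_imset; last exact: enum_rank_inj.
exact: (forall_inP (card_edges G)).
Qed.

Definition ograph_of (G : sgraph) : ograph :=
  Tagged edge_set
    (exist (fun E : {set {set 'I_#|G|}} => [forall e in E, #|e| == 2] : Prop)
       _ (ograph_of_card G)).

Definition class (G : sgraph) : isoclass := \pi_isoclass (ograph_of G).
Definition rep (c : isoclass) : sgraph := graph_of (repr c).

Lemma giso_ograph_of G : giso G (graph_of (ograph_of G)).
Proof.
pose f : G -> graph_of (ograph_of G) := fun x => enum_rank x.
apply: (@giso_of_adj _ _ f) => [|x y]; first exact: enum_rank_bij.
rewrite /adj /= -imset_pair mem_imset //.
exact/imset_inj/enum_rank_inj.
Qed.

Lemma classP G H : reflect (class G = class H) (giso G H).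
Proof.
have -> : giso G H = ograph_iso (ograph_of G) (ograph_of H).
  apply/idP/idP => GH.
    apply: giso_trans (giso_trans GH (giso_ograph_of H)).
    by rewrite giso_sym giso_ograph_of.
  rewrite (giso_trans (giso_trans (giso_ograph_of G) GH)) //.
  by rewrite giso_sym giso_ograph_of.
by apply: (iffP idP) => [GH|/eqquotP//]; apply/eqquotP.
Qed.

Lemma repK : cancel rep class.
Proof.
move=> c; rewrite -[RHS]reprK; apply/eqquotP.
by rewrite /= /ograph_iso giso_sym giso_ograph_of.
Qed.

Lemma giso_rep G : giso (rep (class G)) G.
Proof. by apply/classP; rewrite repK. Qed.

Lemma adj_gunion G H (u v : gunion G H) :
  adj (gunion G H) u v = match u, v with
    | inl x, inl y => adj G x y
    | inr x, inr y => adj H x y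
    | _, _ => false
    end.
Proof.
rewrite /adj inE; apply/orP/idP => [[] /imsetP[e eG uv]|].
- have : u \in inl @: e by rewrite -uv set21.
  have : v \in inl @: e by rewrite -uv set22.
  move=> /imsetP[y _ vE] /imsetP[x _ uE]; move: uv; rewrite uE vE.
  by rewrite -imset_pair => /imset_inj ->; last by move=> ? ? [].
- have : u \in inr @: e by rewrite -uv set21.
  have : v \in inr @: e by rewrite -uv set22.
  move=> /imsetP[y _ vE] /imsetP[x _ uE]; move: uv; rewrite uE vE.
  by rewrite -imset_pair => /imset_inj ->; last by move=> ? ? [].
case: u v => [x|x] [y|y] //= xy; first by left; rewrite -imset_pair imset_f.
by right; rewrite -imset_pair imset_f.
Qed.

Lemma giso_gunion G G' H H' :
  giso G G' -> giso H H' -> giso (gunion G H) (gunion G' H').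
Proof.
move=> /giso_adj[f [f' fK f'K] fa] /giso_adj[g [g' gK g'K] ga].
pose h (u : gunion G H) : gunion G' H' :=
  match u with inl x => inl (f x) | inr x => inr (g x) end.
apply: (@giso_of_adj _ _ h).
  exists (fun u => match u with inl x => inl (f' x) | inr x => inr (g' x) end).
  - by case=> x /=; rewrite ?fK ?gK.
  - by case=> x /=; rewrite ?f'K ?g'K.
by move=> [x|x] [y|y]; rewrite !adj_gunion /= ?fa ?ga.
Qed.

Definition cunion (c d : isoclass) : isoclass := class (gunion (rep c) (rep d)).
Definition cempty : isoclass := class gempty.

Lemma class_gunion G H : class (gunion G H) = cunion (class G) (class H).
Proof. by apply/esym/classP/giso_gunion; apply: giso_rep. Qed.

Lemma cunionA : associative cunion.
Proof.
move=> c d e; rewrite -[c]repK -[d]repK -[e]repK -!class_gunion.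
set G := rep c; set H := rep d; set L := rep e.
pose h (u : gunion G (gunion H L)) : gunion (gunion G H) L :=
  match u with inl x => inl (inl x) | inr (inl x) => inl (inr x)
             | inr (inr x) => inr x end.
apply/classP/(@giso_of_adj _ _ h).
  exists (fun u => match u with inl (inl x) => inl x
             | inl (inr x) => inr (inl x) | inr x => inr (inr x) end).
  - by case=> [x|[]].
  - by case=> [[]|].
by move=> [x|[x|x]] [y|[y|y]]; do !rewrite !adj_gunion /=.
Qed.

Lemma cunionC : commutative cunion.
Proof.
move=> c d; apply/classP.
pose sw (T U : Type) (u : T + U) : U + T :=
  match u with inl x => inr x | inr x => inl x end.
apply: (@giso_of_adj (gunion _ _) (gunion _ _) (sw _ _)).
  by exists (sw _ _); case.
by move=> [x|x] [y|y]; rewrite !adj_gunion.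
Qed.

Lemma cunion0c : left_id cempty cunion.
Proof.
move=> c; rewrite -[c]repK -class_gunion; apply/esym/classP.
apply: (@giso_of_adj _ (gunion gempty _) inr) => [|x y]; last by rewrite adj_gunion.
by exists (fun u => match u with inl x => of_void _ x | inr x => x end); case.
Qed.

Lemma cunionc0 : right_id cempty cunion.
Proof. by move=> c; rewrite cunionC cunion0c. Qed.

Lemma card0_class (G : sgraph) : #|G| = 0%N -> class G = cempty.
Proof.
move=> /card0_eq G0; have {}G0 (x : G) : False by have := G0 x; rewrite inE.
apply/classP/(@giso_of_adj _ gempty (fun x => False_rect _ (G0 x))).
  by exists (@of_void G) => x //; case: (G0 x).
by move=> x; case: (G0 x).
Qed.

Lemma giso_card (G H : sgraph) : giso G H -> #|G| = #|H|.
Proof. by move=> /giso_adj[f fb _]; apply: bij_eq_card fb. Qed.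

Lemma cunion_eq0 c d : cunion c d = cempty -> c = cempty /\ d = cempty.
Proof.
move=> /classP/giso_card; rewrite card_void card_sum => /eqP.
by rewrite addn_eq0 => /andP[/eqP c0 /eqP d0]; rewrite -[c]repK -[d]repK !card0_class.
Qed.

HB.instance Definition _ := Choice_isMonomialDef.Build isoclass
  cunionA cunion0c cunionc0 cunion_eq0.
HB.instance Definition _ := MonomialDef_isConomialDef.Build isoclass cunionC.

(* The commutative algebra H_G: the monoid algebra of isoclasses under       *)
(* disjoint union. Its basis vectors are << c >>, its tensor square has the  *)
(* pairs of isoclasses as basis.                                             *)
Notation HG K := {malg K[isoclass]}.
Notation HG2 K := {malg K[(isoclass * isoclass)%type]}.

Section LinearExtension.
Variables (K : fieldType) (V : lmodType K).

Definition lin (B : choiceType) (f : B -> V) (x : {malg K[B]}) : V :=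
  \sum_(b <- msupp x) x@_b *: f b.

Lemma lin_is_linear (B : choiceType) (f : B -> V) : linear (lin f).
Proof.
have linE (d : {fset B}) (z : {malg K[B]}) :
    (msupp z `<=` d)%fset -> lin f z = \sum_(b <- d) z@_b *: f b.
  move=> zd; rewrite [LHS](big_fset_incl _ zd) //= => b _ /mcoeff_outdom ->.
  by rewrite scale0r.
move=> a x y; set d := (msupp x `|` msupp y)%fset.
rewrite (linE d (a *: x + y)); last first.
  apply: fsubset_trans (msuppD_le _ _) _; apply: fsetSU; exact: msuppZ_le.
rewrite (linE d x) ?fsubsetUl // (linE d y) ?fsubsetUr // scaler_sumr -big_split.
by apply: eq_bigr => b _; rewrite mcoeffD mcoeffZ scalerDl scalerA.
Qed.

Lemma lin_basis (B : choiceType) (f : B -> V) (b : B) : lin f << b >> = f b.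
Proof. by rewrite /lin msuppU oner_eq0 big_seq_fset1 mcoeffUU scale1r. Qed.

(* The linear map on H_G whose value on (the isoclass of) a graph G is f G. *)
Definition glin (f : sgraph -> V) : HG K -> V := lin (f \o rep).

Lemma glin_class (f : sgraph -> V) G :
  (forall H L, giso H L -> f H = f L) -> glin f << class G >> = f G.
Proof. by move=> fi; rewrite /glin lin_basis /=; apply/fi/giso_rep. Qed.

End LinearExtension.

Section ChromaticPolynomial.
Variable G : sgraph.

Definition proper_colorings (k : nat) : {set {ffun G -> 'I_k}} :=
  [set f : {ffun G -> 'I_k} |
    [forall x : G, forall y : G, adj G x y ==> (f x != f y)]].

Lemma card_constant_on_components (k : nat) (F : {set {set G}}) :
  #|[set f : {ffun G -> 'I_k} |
      [forall x : G, forall y : G, adj (spanning F) x y ==> (f x == f y)]]|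
  = (k ^ cc (spanning F))%N.
Proof.
set e := adj (spanning F).
have symc : connect_sym e by apply: sym_connect_sym; apply: adj_sym.
pose R : finType := {x : G | x \in roots e}.
pose rt (x : G) : R := exist _ (fingraph.root e x) (roots_root symc x).
pose h (g : {ffun R -> 'I_k}) : {ffun G -> 'I_k} := [ffun x => g (rt x)].
have rtK (r : R) : rt (sval r) = r.
  by apply: val_inj; apply/eqP; apply: (valP r).
have h_inj : injective h.
  move=> g g' /ffunP gg'; apply/ffunP => r.
  by have := gg' (sval r); rewrite !ffunE rtK.
rewrite -[k in RHS]card_ord.
have -> : cc (spanning F) = #|R|.
  by rewrite card_sig; apply: eq_card => x; rewrite !inE andbT.
rewrite -card_ffun -cardsT -(card_imset _ h_inj); apply: eq_card => f.
rewrite !inE; apply/idP/imsetP => [/forallP fP|[g _ ->]]; last first.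
  apply/forallP => x; apply/forallP => y; apply/implyP => xy; rewrite !ffunE.
  suff -> : rt x = rt y by [].
  by apply: val_inj; apply/(fingraph.rootP symc)/connect1.
have fc x y : connect e x y -> f x = f y.
  move=> /connectP[p + ->]; elim: p x => //= z p IH x /andP[xz /IH <-].
  by apply/eqP; have /forallP/(_ z)/implyP := fP x; apply.
exists [ffun r : R => f (sval r)] => //; apply/ffunP => x; rewrite !ffunE /=.
exact/fc/connect_root.
Qed.

Lemma card_proper_colorings (R : comNzRingType) (k : nat) :
  #|proper_colorings k|%:R =
  \sum_(F : {set {set G}} | F \subset edges G)
     (-1) ^+ #|F| * k%:R ^+ cc (spanning F) :> R.
Proof.
pose mono (f : {ffun G -> 'I_k}) (e : {set G}) :=
  [forall x : G, forall y : G, (e == [set x; y]) ==> (f x == f y)].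
have properE (f : {ffun G -> 'I_k}) :
    (f \in proper_colorings k)%:R
    = \prod_(e in edges G) (1 - (mono f e)%:R) :> R.
  rewrite inE; case: (boolP [forall e in edges G, ~~ mono f e]) => [/forall_inP nm|].
    rewrite big1 => [|e /nm/negbTE ->]; last by rewrite subr0.
    suff -> : [forall x : G, forall y : G, adj G x y ==> (f x != f y)] by [].
    apply/forallP => x; apply/forallP => y; apply/implyP => /nm; apply: contra.
    move=> /eqP fxy; apply/forallP => x'; apply/forallP => y'; apply/implyP => /eqP xy.
    have : x' \in [set x; y] by rewrite xy set21.
    have : y' \in [set x; y] by rewrite xy set22.
    by rewrite !inE => /pred2P[] -> /pred2P[] ->; rewrite ?fxy.
  rewrite negb_forall_in => /exists_inP[e eG]; rewrite negbK => me.
  rewrite (bigD1 e) //= me subrr mul0r.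
  have [x [y [xy ee]]] := edgesP _ eG.
  suff -> : [forall x : G, forall y : G, adj G x y ==> (f x != f y)] = false by [].
  apply/negbTE; rewrite negb_forall; apply/existsP; exists x.
  rewrite negb_forall; apply/existsP; exists y; rewrite xy negbK.
  by have /forallP/(_ x)/forallP/(_ y) := me; rewrite ee eqxx.
rewrite -sum1_card natr_sum big_mkcond /=.
transitivity (\sum_(f : {ffun G -> 'I_k})
    \sum_(F : {set {set G}} | F \subset edges G)
       (-1) ^+ #|F| * ([forall x : G, forall y : G,
          adj (spanning F) x y ==> (f x == f y)])%:R : R).
  apply: eq_bigr => f _; rewrite -[LHS]/((if _ then _ else _) : R).
  transitivity ((f \in proper_colorings k)%:R : R); first by case: ifP.
  rewrite properE big_mkcond /=.
  transitivity (\prod_(e : {set G})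
      ((if e \in edges G then - (mono f e)%:R else 0) + 1 : R)).
    by apply: eq_bigr => e _; case: ifP; rewrite ?add0r // addrC.
  rewrite bigA_distr [RHS]big_mkcond /=; apply: eq_bigr => F _.
  case: ifP => [FG|/negbT/subsetPn[e eF /negbTE eG]]; last first.
    by rewrite (bigD1 e) //= eF eG mul0r.
  rewrite -big_mkcond /=.
  rewrite (eq_bigr (fun e => (-1) * (mono f e)%:R)); last first.
    by move=> e eF; rewrite (subsetP FG) // mulN1r.
  rewrite big_split /= prodr_const; congr (_ * _).
  case: (boolP [forall e in F, mono f e]) => [/forall_inP m|].
    rewrite big1 => [|e /m -> //]; suff -> : [forall x : G, forall y : G,
      adj (spanning F) x y ==> (f x == f y)] by [].
    apply/forallP => x; apply/forallP => y; apply/implyP; rewrite /adj inE.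
    move=> /andP[/m/forallP/(_ x)/forallP/(_ y)]; by rewrite eqxx.
  rewrite negb_forall_in => /exists_inP[e eF nm]; rewrite (bigD1 e) //=.
  rewrite (negbTE nm) mul0r; move: nm; rewrite negb_forall => /existsP[x].
  rewrite negb_forall => /existsP[y]; rewrite negb_imply => /andP[/eqP ee nf].
  suff -> : [forall x : G, forall y : G, adj (spanning F) x y ==> (f x == f y)]
    = false by [].
  apply/negbTE; rewrite negb_forall; apply/existsP; exists x.
  rewrite negb_forall; apply/existsP; exists y.
  by rewrite negb_imply nf /adj inE -ee eF (subsetP FG).
rewrite exchange_big; apply: eq_bigr => F _; rewrite -big_distrr /=; congr (_ * _).
rewrite -natrX -card_constant_on_components -sum1_card natr_sum big_mkcond /=.
by rewrite [RHS]big_mkcond; apply: eq_bigr => f _; rewrite inE; case: ifP.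
Qed.

Lemma chromatic_exists (K : fieldType) :
  {p : {poly K} | forall k : nat, p.[k%:R] = #|proper_colorings k|%:R}.
Proof.
exists (\sum_(F : {set {set G}} | F \subset edges G)
   (-1) ^+ #|F| *: 'X^(cc (spanning F))) => k.
rewrite card_proper_colorings horner_sum; apply: eq_bigr => F _.
by rewrite hornerZ hornerXn.
Qed.

Definition chromatic (K : fieldType) : {poly K} := sval (chromatic_exists K).

Lemma chromaticE (K : fieldType) (k : nat) :
  (chromatic K).[k%:R] = #|proper_colorings k|%:R.
Proof. exact: (svalP (chromatic_exists K)). Qed.

Lemma chromatic_unique (K : fieldType) (p : {poly K}) :
  [pchar K] =i pred0 ->
  (forall k : nat, p.[k%:R] = #|proper_colorings k|%:R) -> p = chromatic K.
Proof.
move=> /pcharf0P K0 pP; apply/eqP; rewrite -subr_eq0; apply/eqP.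
set q := p - _; apply: (@roots_geq_poly_eq0 _ q [seq k%:R | k <- iota 0 (size q)]).
- apply/allP => _ /mapP[k _ ->]; rewrite /root hornerD hornerN pP.
  by rewrite (svalP (chromatic_exists K)) subrr.
- rewrite map_inj_uniq ?iota_uniq // => i j /eqP; wlog ij : i j / (i <= j)%N.
    by move=> W; case/orP: (leq_total i j) => /W // W'; rewrite eq_sym => /W'.
  rewrite eq_sym -subr_eq0 -natrB // K0 subn_eq0 => ji.
  by apply/eqP; rewrite eqn_leq ij.
- by rewrite size_map size_iota.
Qed.

End ChromaticPolynomial.

Section HopfAlgebraOfGraphs.
Variable K : fieldType.

Definition Delta_graph (G : sgraph) : HG2 K :=
  \sum_(I : {set G}) << (class (induced I), class (induced (~: I))) >>.

Definition Delta : HG K -> HG2 K := glin Delta_graph.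

Definition eps_Delta : HG K -> K :=
  glin (fun G => (#|G| == 0%N)%:R : K^o).

Definition delta_graph (G : sgraph) : HG2 K :=
  \sum_(r in Ec G) << (class (contract r), class (restrict r)) >>.

Definition delta : HG K -> HG2 K := glin delta_graph.

Definition is_character (l : HG K -> K) : Prop :=
  scalar l /\ monoid_morphism l.

(* The right action of a character: (phi (x) l) o delta, where K[X] (x) K is  *)
(* identified with K[X].                                                     *)
Definition act (phi : HG K -> {poly K}) (l : HG K -> K) (x : HG K) : {poly K} :=
  lin (fun b : isoclass * isoclass => l << b.2 >> *: phi << b.1 >>) (delta x).

End HopfAlgebraOfGraphs.

(* The Hopf algebra K[X]; its tensor square is K[X_0, X_1], where X_0 and X_1 *)
(* stand for X (x) 1 and 1 (x) X.                                             *)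
Section HopfAlgebraOfPolynomials.
Import mpoly.
Variable K : fieldType.

Definition poly_tensor (p q : {poly K}) : mpoly 2 K :=
  horner_alg 'X_ord0 p * horner_alg 'X_ord_max q.

Definition poly_Delta (p : {poly K}) : mpoly 2 K :=
  horner_alg ('X_ord0 + 'X_ord_max) p.

Definition poly_eps (p : {poly K}) : K := p.[0].

(* The map f (x) f from the tensor square of H_G to the one of K[X]. *)
Definition tensor_square (f : HG K -> {poly K}) : HG2 K -> mpoly 2 K :=
  lin (fun b : isoclass * isoclass => poly_tensor (f << b.1 >>) (f << b.2 >>)).

(* A morphism of bialgebras; between Hopf algebras it automatically commutes *)
(* with the antipodes.                                                       *)
Definition hopf_morphism (f : HG K -> {poly K}) : Prop :=
  [/\ linear f, monoid_morphism f,
      forall x, poly_Delta (f x) = tensor_square f (Delta x)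
    & forall x, poly_eps (f x) = eps_Delta x].

End HopfAlgebraOfPolynomials.

Section Invariants.
Variable K : fieldType.

(* Z_G(X, Y), with X the inner and Y the outer variable. *)
Definition fortuin_kasteleyn (G : sgraph) : {poly {poly K}} :=
  \sum_(F : {set {set G}} | F \subset edges G)
     ('X ^+ cc (spanning F))%:P * 'X ^+ #|F|.

(* A covering graph H of G is given by its set of edges F = E(H). *)
Definition covering (G : sgraph) : {set {set {set G}}} :=
  [set F : {set {set G}} | F \subset edges G & cc (spanning F) == cc G].

Definition zeta (y : K) : HG K -> {poly K} :=
  glin (fun G => (fortuin_kasteleyn G).[y%:P]).

Definition lambda (y : K) : HG K -> K :=
  glin (fun G => \sum_(F in covering G) y ^+ #|F| : K^o).

Definition mu (y : K) : HG K -> K :=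
  glin (fun G => (1 + y) ^+ #|edges G| : K^o).

Definition phi0 : HG K -> {poly K} := glin (fun G => 'X ^+ #|G|).

Definition phi_chr : HG K -> {poly K} := glin (fun G => chromatic G K).

End Invariants.

(* The values on graphs used above are isomorphism invariant. *)
Section IsoInvariance.
Variables (G H : sgraph) (f : G -> H) (g : H -> G).
Hypotheses (fK : cancel f g) (gK : cancel g f).
Hypothesis fa : forall x y, adj H (f x) (f y) = adj G x y.

Let fb : bijective f. Proof. by exists g. Qed.
Let f_inj : injective f. Proof. exact: can_inj fK. Qed.

Lemma connect_iso x y : connect (adj H) (f x) (f y) = connect (adj G) x y.
Proof.
apply/idP/idP => /connectP[p].
  elim: p x => [|z p IH] x /=; first by move=> _ /f_inj ->; apply: connect0.
  rewrite -[z]gK fa => /andP[xz pP] pl; apply: connect_trans (connect1 xz) _.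
  exact: IH.
elim: p x => [|z p IH] x /=; first by move=> _ ->; apply: connect0.
move=> /andP[xz pP] pl; apply: connect_trans (IH _ pP pl).
by apply: connect1; rewrite fa.
Qed.

Lemma cc_iso_aux : cc H = cc G.
Proof.
apply: (adjunction_n_comp f); try exact/sym_connect_sym/adj_sym; first by [].
split=> [x _|x y _]; last by rewrite connect_iso.
by exists (g x); rewrite gK connect0.
Qed.

Lemma gconnected_iso_aux : gconnected H = gconnected G.
Proof.
apply/forallP/forallP => /= cP x; apply/forallP => y.
  by rewrite -connect_iso; apply: (forallP (cP (f x))).
by rewrite -[x]gK -[y]gK connect_iso; apply: (forallP (cP (g x))).
Qed.

Lemma mem_edges_iso (e : {set G}) : (f @: e \in edges H) = (e \in edges G).
Proof.
apply/edgesP/edgesP => [[x [y [xy ee]]]|[x [y [xy ->]]]].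
  exists (g x), (g y); split; first by rewrite -fa !gK.
  by apply: (imset_inj f_inj); rewrite imset_pair !gK.
by exists (f x), (f y); rewrite fa imset_pair.
Qed.

End IsoInvariance.

Lemma cc_iso G H : giso G H -> cc G = cc H.
Proof. by case/giso_adj => f [g fK gK] fa; rewrite (cc_iso_aux fK gK fa). Qed.

Lemma gconnected_iso G H : giso G H -> gconnected G = gconnected H.
Proof. by case/giso_adj => f [g fK gK] fa; rewrite (gconnected_iso_aux fK gK fa). Qed.

Lemma adj_spanning (G : sgraph) (F : {set {set G}}) x y :
  adj (spanning F) x y = ([set x; y] \in F) && adj G x y.
Proof. by rewrite /adj inE. Qed.

Lemma adj_induced (G : sgraph) (I : {set G}) (x y : induced I) :
  adj (induced I) x y = adj G (val x) (val y).
Proof. by rewrite /adj inE imset_pair. Qed.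

Lemma adj_contract (G : sgraph) (r : {set G * G}) (u v : contract r) :
  adj (contract r) u v =
  (u != v) && [exists p : G * G,
     [&& adj G p.1 p.2, qpi r p.1 == u & qpi r p.2 == v]].
Proof.
rewrite /adj; apply/imsetP/andP => [[[x y]]|[uv /existsP[[x y]]]] /=.
  rewrite inE /= => /andP[xy nxy] uv.
  have : u \in [set qpi r x; qpi r y] by rewrite -uv set21.
  have : v \in [set qpi r x; qpi r y] by rewrite -uv set22.
  have : qpi r x \in [set u; v] by rewrite uv set21.
  have : qpi r y \in [set u; v] by rewrite uv set22.
  rewrite !inE => yuv xuv vxy uxy.
  case: (eqVneq u v) uv yuv xuv => [<-|nuv] _ yuv xuv.
    by move: yuv xuv nxy; rewrite !orbb => /eqP -> /eqP ->; rewrite eqxx.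
  split=> //; apply/existsP; case/orP: uxy => /eqP uE; case/orP: vxy => /eqP vE.
  - by rewrite uE vE eqxx in nuv.
  - by exists (x, y); apply/and3P; split; rewrite ?uE ?vE.
  - by exists (y, x); apply/and3P; split; rewrite ?uE ?vE // setUC.
  - by rewrite uE vE eqxx in nuv.
move=> /and3P[xy /eqP xu /eqP yv]; exists (x, y); last by rewrite xu yv.
by rewrite inE; apply/andP; split; rewrite //= xu yv.
Qed.

Lemma adj_restrict (G : sgraph) (r : {set G * G}) x y :
  adj (restrict r) x y = adj G x y && (qpi r x == qpi r y).
Proof.
rewrite {1}/adj; apply/imsetP/andP => [[[x' y']]|[xy rxy]] /=; last first.
  by exists (x, y); rewrite // inE; apply/andP.
rewrite inE /= => /andP[xy rxy] E; split; first by rewrite /adj E.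
have : x \in [set x'; y'] by rewrite -E set21.
have : y \in [set x'; y'] by rewrite -E set22.
by rewrite !inE => /pred2P[] -> /pred2P[] ->; rewrite ?eqxx // eq_sym.
Qed.

Lemma giso_induced (G H : sgraph) (f : G -> H) (g : H -> G) (J : {set H}) :
  cancel f g -> cancel g f -> (forall x y, adj H (f x) (f y) = adj G x y) ->
  giso (induced (f @^-1: J)) (induced J).
Proof.
move=> fK gK fa.
have inJ (x : {x | x \in f @^-1: J}) : f (val x) \in J.
  by case: x => x /=; rewrite inE.
have inI (x : {x | x \in J}) : g (val x) \in f @^-1: J.
  by case: x => x /=; rewrite inE gK.
pose h (x : induced (f @^-1: J)) : induced J := exist _ (f (val x)) (inJ x).
apply: (@giso_of_adj _ _ h) => [|x y]; last by rewrite !adj_induced fa.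
by exists (fun x => exist _ (g (val x)) (inI x)) => x; apply: val_inj; rewrite /= ?fK ?gK.
Qed.

Lemma giso_spanning (G H : sgraph) (f : G -> H) (g : H -> G) (F : {set {set H}}) :
  cancel f g -> cancel g f -> (forall x y, adj H (f x) (f y) = adj G x y) ->
  giso (spanning [set e : {set G} | f @: e \in F]) (spanning F).
Proof.
move=> fK gK fa.
apply: (@giso_of_adj (spanning _) (spanning _) f) => [|x y]; first by exists g.
by rewrite !adj_spanning fa inE imset_pair.
Qed.

Section RelationIso.
Variables (G H : sgraph) (f : G -> H) (g : H -> G).
Hypotheses (fK : cancel f g) (gK : cancel g f).
Hypothesis fa : forall x y, adj H (f x) (f y) = adj G x y.
Variable s : {set H * H}.

Definition relpre : {set G * G} := [set p | (f p.1, f p.2) \in s].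

Lemma eqclass_relpre x : eqclass relpre x = f @^-1: eqclass s (f x).
Proof. by apply/setP => y; rewrite !inE. Qed.

Lemma eq_qpi_relpre x y : (qpi relpre x == qpi relpre y) = (qpi s (f x) == qpi s (f y)).
Proof.
apply/eqP/eqP => /(congr1 val) /= E; apply: val_inj => /=; move: E.
  rewrite !eqclass_relpre => /setP E; apply/setP => z.
  by have := E (g z); rewrite !inE gK.
by rewrite !eqclass_relpre => ->.
Qed.

Lemma is_equivalence_relpre : is_equivalence relpre = is_equivalence s.
Proof.
congr [&& _, _ & _].
- apply/forallP/forallP => P x; first by have := P (g x); rewrite inE /= gK.
  by rewrite inE.
- apply/forallP/forallP => P x; apply/forallP => y.
    by have /forallP/(_ (g y)) := P (g x); rewrite !inE /= !gK.
  by have /forallP/(_ (f y)) := P (f x); rewrite !inE.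
- apply/forallP/forallP => P x; apply/forallP => y; apply/forallP => z.
    by have /forallP/(_ (g y))/forallP/(_ (g z)) := P (g x); rewrite !inE /= !gK.
  by have /forallP/(_ (f y))/forallP/(_ (f z)) := P (f x); rewrite !inE.
Qed.

Lemma Ec_relpre : (relpre \in Ec G) = (s \in Ec H).
Proof.
rewrite !inE is_equivalence_relpre; congr (_ && _).
have cE x : gconnected (induced (eqclass relpre x))
          = gconnected (induced (eqclass s (f x))).
  by rewrite eqclass_relpre; apply/gconnected_iso/(giso_induced _ fK gK fa).
apply/forallP/forallP => P x; first by rewrite -[x]gK -cE.
by rewrite cE.
Qed.

Lemma giso_restrict : giso (restrict relpre) (restrict s).
Proof.
apply: (@giso_of_adj (restrict _) (restrict _) f) => [|x y]; first by exists g.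
by rewrite !adj_restrict fa eq_qpi_relpre.
Qed.

Lemma qpi_surj (V : finType) (r : {set V * V}) (u : quot r) : exists x, qpi r x == u.
Proof. by case: u => B Br; have /imsetP[x _ BE] := Br; exists x; apply/eqP/val_inj. Qed.

Lemma giso_contract : giso (contract relpre) (contract s).
Proof.
pose rp (u : contract relpre) : G := xchoose (qpi_surj u).
pose rs (v : contract s) : H := xchoose (qpi_surj v).
have rpK u : qpi relpre (rp u) = u by apply/eqP/(xchooseP (qpi_surj u)).
have rsK v : qpi s (rs v) = v by apply/eqP/(xchooseP (qpi_surj v)).
pose h (u : contract relpre) : contract s := qpi s (f (rp u)).
have hE x : h (qpi relpre x) = qpi s (f x).
  by apply/eqP; rewrite /h -eq_qpi_relpre rpK.
have h_bij : bijective h.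
  exists (fun v => qpi relpre (g (rs v))) => w; last by rewrite hE gK rsK.
  by rewrite -[RHS]rpK; apply/eqP; rewrite eq_qpi_relpre gK rsK.
apply: (giso_of_adj h_bij) => u v; rewrite !adj_contract (bij_eq h_bij).
congr (_ && _); apply/existsP/existsP => -[[x y] /= /and3P[xy /eqP xu /eqP yv]].
  exists (g x, g y); rewrite /= -fa !gK xy -(bij_eq h_bij) -(bij_eq h_bij _ v).
  by rewrite !hE !gK xu yv !eqxx.
by exists (f x, f y); rewrite /= fa xy -!hE xu yv !eqxx.
Qed.

End RelationIso.

Section ValuesOnGraphs.
Variable K : fieldType.

Lemma preimset_bij (T U : finType) (f : T -> U) (g : U -> T) :
  cancel f g -> cancel g f -> bijective (fun J : {set U} => f @^-1: J).
Proof.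
move=> fK gK; exists (fun I : {set T} => g @^-1: I) => I.
  by apply/setP => x; rewrite !inE gK.
by apply/setP => x; rewrite !inE fK.
Qed.

Lemma imset_cancel (T U : finType) (f : T -> U) (g : U -> T) :
  cancel f g -> cancel (fun e : {set T} => f @: e) (fun e : {set U} => g @: e).
Proof.
by move=> fK e; rewrite -imset_comp (eq_imset (g := id)) ?imset_id.
Qed.

Lemma Delta_graph_iso (G H : sgraph) : giso G H -> Delta_graph K G = Delta_graph K H.
Proof.
case/giso_adj => f [g fK gK] fa; rewrite /Delta_graph.
rewrite (reindex (fun J : {set H} => f @^-1: J)) /=; last first.
  exact/onW_bij/(preimset_bij fK gK).
apply: eq_bigr => J _; congr << (_, _) >>; apply/classP; rewrite -?preimsetC;
exact: giso_induced fK gK fa.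
Qed.

Lemma delta_graph_iso (G H : sgraph) : giso G H -> delta_graph K G = delta_graph K H.
Proof.
case/giso_adj => f [g fK gK] fa; rewrite /delta_graph.
rewrite (reindex (relpre f)) /=; last first.
  apply/onW_bij; exists (relpre g) => s; apply/setP => -[x y];
  by rewrite !inE /= ?fK ?gK.
apply: eq_big => [s|s _]; first exact: (Ec_relpre fK gK fa).
congr << (_, _) >>; apply/classP.
- exact: (giso_contract gK fa).
- exact: (giso_restrict fK gK fa).
Qed.

Section EdgeSums.
Variables (G H : sgraph) (f : G -> H) (g : H -> G).
Hypotheses (fK : cancel f g) (gK : cancel g f).
Hypothesis fa : forall x y, adj H (f x) (f y) = adj G x y.

Let pre (F : {set {set H}}) : {set {set G}} := [set e : {set G} | f @: e \in F].

Lemma edge_pre_bij : bijective pre.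
Proof.
have -> : pre = (fun F => (fun e : {set G} => f @: e) @^-1: F) by [].
exact: preimset_bij (imset_cancel fK) (imset_cancel gK).
Qed.

Lemma sub_edge_pre F : (pre F \subset edges G) = (F \subset edges H).
Proof.
apply/subsetP/subsetP => FE e.
  move=> eF; have eE : f @: (g @: e) = e by apply: imset_cancel.
  by rewrite -eE (mem_edges_iso fK gK fa) FE // inE eE.
by rewrite inE => /FE; rewrite (mem_edges_iso fK gK fa).
Qed.

Lemma card_edge_pre F : #|pre F| = #|F|.
Proof.
rewrite -(card_imset _ (imset_inj (can_inj fK))); apply: eq_card => e.
apply/imsetP/idP => [[e' + ->]|eF]; first by rewrite inE.
have eE : f @: (g @: e) = e by apply: imset_cancel.
by exists (g @: e); rewrite ?inE eE.
Qed.

Lemma cc_edge_pre F : cc (spanning (pre F)) = cc (spanning F).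
Proof. exact/cc_iso/(giso_spanning _ fK gK fa). Qed.

End EdgeSums.

Lemma card_edges_iso (G H : sgraph) : giso G H -> #|edges G| = #|edges H|.
Proof.
case/giso_adj => f [g fK gK] fa; rewrite -(card_edge_pre fK gK).
by apply: eq_card => e; rewrite inE (mem_edges_iso fK gK fa).
Qed.

Lemma fortuin_kasteleyn_iso (G H : sgraph) :
  giso G H -> fortuin_kasteleyn K G = fortuin_kasteleyn K H.
Proof.
case/giso_adj => f [g fK gK] fa; rewrite /fortuin_kasteleyn.
rewrite (reindex _ (onW_bij _ (edge_pre_bij fK gK))) /=.
apply: eq_big => F; first exact: (sub_edge_pre fK gK fa).
by rewrite (cc_edge_pre fK gK fa) (card_edge_pre fK gK).
Qed.

Lemma covering_sum_iso (y : K) (G H : sgraph) : giso G H ->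
  \sum_(F in covering G) y ^+ #|F| = \sum_(F in covering H) y ^+ #|F|.
Proof.
move=> GH; have ccGH := cc_iso GH; case/giso_adj: GH => f [g fK gK] fa.
rewrite (reindex _ (onW_bij _ (edge_pre_bij fK gK))) /=.
apply: eq_big => F; last by rewrite (card_edge_pre fK gK).
by rewrite !inE (sub_edge_pre fK gK fa) (cc_edge_pre fK gK fa) ccGH.
Qed.

Lemma card_proper_colorings_iso (G H : sgraph) (k : nat) :
  giso G H -> #|proper_colorings G k| = #|proper_colorings H k|.
Proof.
case/giso_adj => f [g fK gK] fa.
pose h (c : {ffun H -> 'I_k}) : {ffun G -> 'I_k} := [ffun x => c (f x)].
have h_inj : injective h.
  move=> c d /ffunP cd; apply/ffunP => x.
  by have := cd (g x); rewrite !ffunE gK.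
rewrite -(card_imset _ h_inj); apply: eq_card => c.
rewrite inE; apply/idP/imsetP => [cP|[d dP ->]].
  exists [ffun x => c (g x)]; last by apply/ffunP => x; rewrite !ffunE fK.
  rewrite inE; apply/forallP => x; apply/forallP => y; rewrite !ffunE.
  by have /forallP/(_ (g x))/forallP/(_ (g y)) := cP; rewrite -fa !gK.
move: dP; rewrite inE => dP; apply/forallP => x; apply/forallP => y.
by rewrite !ffunE -fa; have /forallP/(_ (f x))/forallP := dP; apply.
Qed.

Lemma chromatic_iso (G H : sgraph) :
  [pchar K] =i pred0 -> giso G H -> chromatic G K = chromatic H K.
Proof.
move=> K0 GH; apply: chromatic_unique => // k.
by rewrite (svalP (chromatic_exists G K)) (card_proper_colorings_iso _ GH).
Qed.

(* The maps above take the expected values on every graph, not only on the  *)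
(* chosen representatives.                                                   *)
Variable G : sgraph.

Lemma Delta_class : Delta << class G >> = Delta_graph K G.
Proof. by rewrite /Delta glin_class //; apply: Delta_graph_iso. Qed.

Lemma eps_Delta_class : eps_Delta << class G >> = (#|G| == 0%N)%:R :> K.
Proof. by rewrite /eps_Delta glin_class // => H L /giso_card ->. Qed.

Lemma delta_class : delta << class G >> = delta_graph K G.
Proof. by rewrite /delta glin_class //; apply: delta_graph_iso. Qed.

Lemma zeta_class (y : K) : zeta y << class G >> = (fortuin_kasteleyn K G).[y%:P].
Proof. by rewrite /zeta glin_class // => H L /fortuin_kasteleyn_iso ->. Qed.

Lemma lambda_class (y : K) :
  lambda y << class G >> = \sum_(F in covering G) y ^+ #|F|.
Proof. by rewrite /lambda glin_class //; apply: covering_sum_iso. Qed.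

Lemma mu_class (y : K) : mu y << class G >> = (1 + y) ^+ #|edges G|.
Proof. by rewrite /mu glin_class // => H L /card_edges_iso ->. Qed.

Lemma phi0_class : @phi0 K << class G >> = 'X ^+ #|G|.
Proof. by rewrite /phi0 glin_class // => H L /giso_card ->. Qed.

Lemma phi_chr_class :
  [pchar K] =i pred0 -> @phi_chr K << class G >> = chromatic G K.
Proof. by move=> K0; rewrite /phi_chr glin_class // => H L; apply: chromatic_iso. Qed.

End ValuesOnGraphs.

(* Main.v *)
Require Import Defs.
From mathcomp Require mpoly.
From mathcomp Require Import monalg.
From mathcomp Require Import all_boot all_order all_algebra.
From mathcomp Require Import finmap.

Set Implicit Arguments.
Unset Strict Implicit.
Unset Printing Implicit Defensive.

Import GRing.Theory.
Local Open Scope ring_scope.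

(** All the maps involved are linear, so every claim is checked on the class of
    a graph [G]. There [zeta y] takes the value [fk_eval y 'X G], the sum over
    [F \subset edges G] of [y ^+ #|F| *: 'X ^+ cc (spanning F)], an expression
    that makes sense with any element [a] of an algebra in place of ['X].

    Multiplicativity. The edges of a disjoint union are the disjoint union of the
    edges, and both [cc] and [#|F|] are additive ([fk_eval_gunion],
    [covering_sum_gunion]). For [lambda y], moreover, [cc G <= cc (spanning F)],
    so a sum of two numbers of components is minimal only if both terms are.

    Coproduct. For a graph [H], expanding [(a + b) ^+ cc H] amounts to choosing
    which components of [H] receive [a]; their union ranges over the sets [I] of
    vertices that no edge of [H] leaves ([exprD_cc]). Taking [H := spanning F] and
    summing over [I] first, the sets [F] without an edge between [I] and its
    complement are the pairs of a set of edges of [G|I] and one of [G|(~: I)]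
    ([fk_eval_coproduct]).

    [zeta y = act phi0 (lambda y)]. Group the sets [F] according to the relation
    [r] of lying in the same component of [spanning F]. It belongs to [Ec G], has
    [cc (spanning F)] classes, and the [F] that give [r] are exactly the covering
    graphs of [restrict r] ([covering_restrict]).

    [zeta y = act phi_chr (mu y)]. In characteristic 0 it is enough to evaluate
    at natural numbers [k]. As [k ^ cc (spanning F)] counts the colourings that
    are constant along [F], the value of [zeta y] at [k] is the sum over all
    colourings [f] of [(1 + y) ^+ m], with [m] the number of monochromatic edges
    of [f] ([fk_eval_nat]). Group the colourings according to the components [r]
    of their monochromatic graph: it is then [restrict r], and the colourings
    that give [r] are the proper colourings of [contract r]
    ([card_proper_contract]). *)

(** * Linear and multiplicative maps on the graph algebra *)

Lemma linear_fun0 (K : nzRingType) (U V : lmodType K) (f : U -> V) :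
  linear f -> f 0 = 0.
Proof. by move=> lf; have := lf (-1) 0 0; rewrite scaler0 addr0 scaleN1r addNr. Qed.

Lemma eq_linear_basis (K : fieldType) (B : choiceType) (V : lmodType K)
    (f g : {malg K[B]} -> V) :
  linear f -> linear g -> (forall b, f << b >> = g << b >>) -> f =1 g.
Proof.
move=> lf lg fg x; rewrite [x]monalgE; elim: (enum_fset (msupp x)) => [|b s IH].
  by rewrite !big_nil !linear_fun0.
rewrite !big_cons; have -> : << x@_b *g b >> = x@_b *: << b >>.
  by apply/malgP => c; rewrite mcoeffZ !mcoeffU mulr_natr.
by rewrite lf lg fg IH.
Qed.

Lemma eq_linear_graphs (K : fieldType) (V : lmodType K) (f g : HG K -> V) :
  linear f -> linear g ->
  (forall G, f << class G >> = g << class G >>) -> f =1 g.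
Proof.
by move=> lf lg fg; apply: eq_linear_basis => // c; rewrite -[c]repK.
Qed.

Lemma mul_class (K : fieldType) (G H : sgraph) :
  << class G >> * << class H >> = << class (gunion G H) >> :> HG K.
Proof. by rewrite class_gunion malgM_def fgmulUU mulr1. Qed.

(** A linear map is an algebra morphism as soon as it is multiplicative on the
    classes of graphs; [phi] records its values there. *)
Lemma monoid_morphism_graphs (K : fieldType) (A : algType K)
    (f : HG K -> A) (phi : sgraph -> A) :
  linear f -> (forall G, f << class G >> = phi G) ->
  phi gempty = 1 -> (forall G H, phi (gunion G H) = phi G * phi H) ->
  monoid_morphism f.
Proof.
move=> lf fE phi1 phiM; split; first exact: etrans (fE gempty) phi1.
move=> x y; move: x; apply: eq_linear_graphs => [a u v|a u v|G].
- by rewrite mulrDl -scalerAl lf.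
- by rewrite lf mulrDl -scalerAl.
move: y; apply: eq_linear_graphs => [a u v|a u v|H].
- by rewrite mulrDr -scalerAr lf.
- by rewrite lf mulrDr -scalerAr.
(* The explicit transitivity steps avoid rewriting with [fE], which would look
   for instances up to conversion between the classes of different graphs. *)
apply: etrans (congr1 f (mul_class K G H)) _; apply: etrans (fE _) _.
by rewrite phiM -!fE.
Qed.

(** * Connected components *)

Lemma connect_homo (S T : finType) (e : rel S) (e' : rel T) (f : S -> T) x y :
  (forall u v, e u v -> e' (f u) (f v)) -> connect e x y ->
  connect e' (f x) (f y).
Proof.
move=> ee /connectP[p + ->]; elim: p x => [|z p IH] x /=; first by rewrite connect0.
by move=> /andP[xz /IH]; apply: connect_trans; apply/connect1/ee.
Qed.

Lemma connect_eq_fun (S : finType) (T : eqType) (e : rel S) (f : S -> T) x y :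
  (forall u v, e u v -> f u = f v) -> connect e x y -> f x = f y.
Proof.
move=> ef /connectP[p + ->]; elim: p x => [|z p IH] x //=.
by move=> /andP[/ef-> /IH].
Qed.

(** A map whose fibres are the connected components has [cc G] values. *)
Lemma cc_imset (G : sgraph) (T : finType) (f : G -> T) :
  (forall x y, (f x == f y) = connect (adj G) x y) -> cc G = #|f @: [set: G]|.
Proof.
move=> fE; have sG : connect_sym (adj G) by apply/sym_connect_sym/adj_sym.
have -> : f @: [set: G] = f @: [set x | x \in roots (adj G)].
  apply/eqP; rewrite eqEsubset; apply/andP; split; last exact/imsetS/subsetT.
  apply/subsetP => _ /imsetP[x _ ->]; apply/imsetP.
  exists (fingraph.root (adj G) x); first by rewrite inE; apply: roots_root.
  by apply/eqP; rewrite fE connect_root.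
rewrite card_in_imset => [|x y]; last first.
  rewrite !inE => /eqP rx /eqP ry /eqP; rewrite fE => xy.
  by rewrite -rx -ry; apply/(fingraph.rootP sG).
by apply: eq_card => x; rewrite !inE andbT.
Qed.

(** The sets of vertices that no edge leaves, that is, the unions of connected
    components. *)
Definition saturated (G : sgraph) (I : {set G}) : bool :=
  [forall x : G, forall y : G, adj G x y ==> ((x \in I) == (y \in I))].

Lemma saturatedP (G : sgraph) (I : {set G}) :
  reflect (forall x y, adj G x y -> (x \in I) = (y \in I)) (saturated I).
Proof.
apply: (iffP forallP) => [P x y xy|P x].
  by apply/eqP; have /forallP/(_ y)/implyP := P x; apply.
by apply/forallP => y; apply/implyP => /P ->.
Qed.

Lemma connect_induced (G : sgraph) (I : {set G}) (u v : induced I) :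
  saturated I -> connect (adj (induced I)) u v = connect (adj G) (val u) (val v).
Proof.
move=> /saturatedP sI; apply/idP/idP => [|/connectP[p]].
  by apply: (@connect_homo (induced I) G _ _ val) => x y; rewrite adj_induced.
elim: p u => [|z p IH] u /=; first by move=> _ /val_inj ->; apply: connect0.
case/andP=> uz zp vE; have zI : z \in I by rewrite -(sI _ _ uz); apply: (valP u).
pose w : induced I := exist _ z zI.
apply: connect_trans (connect1 _) (IH w zp vE).
by rewrite adj_induced.
Qed.

(** The relation of lying in the same connected component. *)
Definition same_component (G : sgraph) : {set G * G} :=
  [set p | connect (adj G) p.1 p.2].

Lemma same_component_equivalence (G : sgraph) : is_equivalence (same_component G).
Proof.
apply/and3P; split; do 3?[apply/forallP => ?]; rewrite !inE /= ?connect0 //.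
  by rewrite (sym_connect_sym (@adj_sym G)) implybb.
by apply/implyP => /andP[]; apply: connect_trans.
Qed.

Section Equivalences.
Variables (V : finType) (r : {set V * V}).
Hypothesis rE : is_equivalence r.

Lemma is_equivalence_refl x : (x, x) \in r.
Proof. by case/and3P: rE => /forallP. Qed.

Lemma is_equivalence_sym x y : (x, y) \in r -> (y, x) \in r.
Proof. by case/and3P: rE => _ /forallP/(_ x)/forallP/(_ y)/implyP. Qed.

Lemma is_equivalence_trans x y z : (x, y) \in r -> (y, z) \in r -> (x, z) \in r.
Proof.
case/and3P: rE => _ _ /forallP/(_ x)/forallP/(_ y)/forallP/(_ z)/implyP tr xy yz.
by apply: tr; rewrite xy.
Qed.

Lemma eq_qpi x y : (qpi r x == qpi r y) = ((x, y) \in r).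
Proof.
apply/eqP/idP => [/(congr1 val)/setP/(_ y)|xy].
  by rewrite !inE is_equivalence_refl.
apply: val_inj; apply/setP => z; rewrite !inE.
by apply/idP/idP; apply: is_equivalence_trans; rewrite ?xy // is_equivalence_sym.
Qed.

End Equivalences.

Lemma imset_qpi (V : finType) (r : {set V * V}) : qpi r @: [set: V] = [set: quot r].
Proof.
by apply/setP => u; have [x /eqP <-] := qpi_surj u; rewrite inE imset_f.
Qed.

Lemma cc_quot (G : sgraph) : cc G = #|quot (same_component G)|.
Proof.
rewrite (@cc_imset G _ (qpi (same_component G))) ?imset_qpi ?cardsT // => x y.
by rewrite eq_qpi ?same_component_equivalence // inE.
Qed.

(** A coarser equivalence has fewer classes, and strictly fewer unless it is the
    same equivalence. *)
Lemma leqif_card_quot (V : finType) (r s : {set V * V}) :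
  is_equivalence r -> is_equivalence s -> r \subset s ->
  (#|quot s| <= #|quot r| ?= iff (r == s))%N.
Proof.
move=> rE sE /subsetP rs.
pose h (u : quot r) : quot s := qpi s (xchoose (qpi_surj u)).
have hE x : h (qpi r x) = qpi s x.
  apply/eqP; rewrite eq_qpi //; apply: rs; rewrite -eq_qpi //.
  exact: (xchooseP (qpi_surj (qpi r x))).
have hT : h @: [set: quot r] = [set: quot s].
  apply/setP => v; have [x /eqP <-] := qpi_surj v.
  by rewrite inE -hE imset_f.
rewrite -[#|quot s|]cardsT -hT -[#|quot r|]cardsT.
split; first exact: leq_imset_card.
apply/imset_injP/eqP => [hi|re]; last first.
  move=> u v _ _; have [x /eqP <-] := qpi_surj u; have [y /eqP <-] := qpi_surj v.
  by rewrite !hE => /eqP; rewrite eq_qpi // -re -eq_qpi // => /eqP.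
apply/setP => -[x y]; apply/idP/idP; first exact: rs.
by rewrite -!eq_qpi // -!hE => /eqP/hi -> //; rewrite ?inE.
Qed.

Lemma same_component_spanning_Ec (G : sgraph) (F : {set {set G}}) :
  same_component (spanning F) \in Ec G.
Proof.
set r := same_component _; rewrite inE; apply/andP; split.
  exact: (same_component_equivalence (spanning F)).
apply/forallP => x.
pose I : {set spanning F} := eqclass r x.
have sI : saturated I.
  apply/saturatedP => y z yz; rewrite !inE.
  apply: same_connect_r; first exact/sym_connect_sym/adj_sym.
  exact: connect1.
apply/forallP => u; apply/forallP => v.
apply: (@connect_homo (induced I) (induced (eqclass r x)) (adj (induced I)) _ id).
  by move=> y z; rewrite !adj_induced adj_spanning => /andP[].
rewrite connect_induced //.
have := valP u; have := valP v; rewrite !inE /= => xv xu.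
apply: connect_trans xv; rewrite sym_connect_sym //; exact: (@adj_sym (spanning F)).
Qed.

(** The classes of an equivalence in [Ec G] are the components of [restrict r]. *)
Lemma same_component_restrict (G : sgraph) (r : {set G * G}) :
  r \in Ec G -> same_component (restrict r) = r.
Proof.
rewrite inE => /andP[rE /forallP rC]; apply/setP => -[x y]; rewrite inE /=.
rewrite -(eq_qpi rE); apply/idP/eqP => [|xy].
  by apply: connect_eq_fun => u v; rewrite adj_restrict => /andP[_ /eqP].
move: xy => /eqP; rewrite eq_qpi // => xy.
have xI : x \in eqclass r x by rewrite inE is_equivalence_refl.
have yI : y \in eqclass r x by rewrite inE.
have /forallP/(_ (exist _ x xI))/forallP/(_ (exist _ y yI)) := rC x.
apply: (@connect_homo (induced (eqclass r x)) (restrict r) _ _ val) => u v.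
rewrite adj_induced adj_restrict => -> /=; rewrite eq_qpi //.
have := valP u; have := valP v; rewrite !inE => xv xu.
exact: is_equivalence_trans (is_equivalence_sym rE xu) xv.
Qed.

Lemma edges_restrict (G : sgraph) (r : {set G * G}) :
  edges (restrict r) \subset edges G.
Proof.
apply/subsetP => e /edgesP[x [y [+ ->]]].
by rewrite adj_restrict => /andP[].
Qed.

Lemma adj_spanning_restrict (G : sgraph) (r : {set G * G}) (F : {set {set G}}) :
  F \subset edges (restrict r) ->
  adj (@spanning (restrict r) F) =2 adj (spanning F).
Proof.
move=> /subsetP Fr x y; rewrite !adj_spanning; case: (boolP ([set x; y] \in F)) => //=.
by move=> /Fr xy; rewrite /adj xy (subsetP (edges_restrict r)).
Qed.

Lemma sub_edges_restrict (G : sgraph) (r : {set G * G}) (F : {set {set G}}) :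
  is_equivalence r -> F \subset edges G ->
  (F \subset edges (restrict r)) = (same_component (spanning F) \subset r).
Proof.
move=> rE /subsetP FG; apply/subsetP/subsetP => [Fr [x y]|Fr e eF].
  rewrite inE /= -eq_qpi // => xy; apply/eqP; apply: connect_eq_fun xy => u v.
  rewrite adj_spanning => /andP[/Fr uv _].
  by move: (uv : adj (restrict r) u v); rewrite adj_restrict => /andP[_ /eqP].
have [x [y [xy eE]]] := edgesP _ (FG e eF); rewrite {}eE in eF *.
apply/edgesP; exists x, y; split=> //; rewrite adj_restrict xy /= eq_qpi //.
by apply: Fr; rewrite inE; apply: connect1; rewrite adj_spanning eF.
Qed.

(** The covering graphs of [restrict r] are the spanning subgraphs of [G] whose
    components are the classes of [r]: [F \subset edges (restrict r)] says that
    these components refine the classes, and equality of the numbers of components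
    that they coincide with them. *)
Lemma covering_restrict (G : sgraph) (r : {set G * G}) (F : {set {set G}}) :
  r \in Ec G ->
  (F \in covering (restrict r)) =
  (F \subset edges G) && (same_component (spanning F) == r).
Proof.
move=> rEc; have rE : is_equivalence r by move: rEc; rewrite inE => /andP[].
rewrite inE; case: (boolP (F \subset edges (restrict r))) => [Fr|] /=; last first.
  move=> nFr; apply/esym/negP => /andP[FG /eqP Fr]; case/negP: nFr.
  by rewrite sub_edges_restrict // Fr.
have FG := subset_trans Fr (edges_restrict r).
have adjE := adj_spanning_restrict Fr.
rewrite FG !cc_quot (same_component_restrict rEc).
have -> : same_component (@spanning (restrict r) F) = same_component (spanning F).
  by apply/setP => p; rewrite !inE (eq_connect adjE).
rewrite eq_sym; apply: (leqif_card_quot _ rE _).2.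
  exact: (same_component_equivalence (spanning F)).
by rewrite -sub_edges_restrict.
Qed.

(** * Sums over the subsets of a disjoint union *)

(** The injections [u] and [v] need to have disjoint images only on [E1] and [E2]:
    below they are maps between powersets, which both send the empty set to
    itself. *)
Lemma sum_subsets_imsetU (T1 T2 T : finType) (R : nmodType) (u : T1 -> T) (v : T2 -> T)
    (E1 : {set T1}) (E2 : {set T2}) (Phi : {set T} -> R) :
  injective u -> injective v ->
  {in E1 & E2, forall a b, u a != v b} ->
  \sum_(F : {set _} | F \subset u @: E1 :|: v @: E2) Phi F =
  \sum_(F1 : {set _} | F1 \subset E1) \sum_(F2 : {set _} | F2 \subset E2)
    Phi (u @: F1 :|: v @: F2).
Proof.
move=> ui vi uv; rewrite pair_big /=.
rewrite (reindex_onto (fun p : {set T1} * {set T2} => u @: p.1 :|: v @: p.2)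
  (fun F => (E1 :&: u @^-1: F, E2 :&: v @^-1: F))) /=; last first.
  move=> F /subsetP FE; apply/setP => t; rewrite inE.
  apply/orP/idP => [[]/imsetP[a + ->]|tF]; rewrite ?inE; try by case/andP.
  have := FE t tF; rewrite inE => /orP[]/imsetP[a aE ta]; [left|right];
  by rewrite ta imset_f // !inE aE -ta.
apply: eq_bigl => -[F1 F2] /=; apply/andP/andP => [[_ /eqP[<- <-]]|[F1E F2E]].
  by rewrite !subsetIl.
split; first by rewrite setUSS ?imsetS.
rewrite xpair_eqE; apply/andP; split; apply/eqP/setP => a; rewrite !inE.
- rewrite mem_imset //; case: (boolP (a \in F1)) => [/(subsetP F1E)-> //|_] /=.
  apply/negP => /andP[aE /imsetP[b /(subsetP F2E) bE ab]].
  by have := uv a b aE bE; rewrite ab eqxx.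
- rewrite orbC mem_imset //; case: (boolP (a \in F2)) => [/(subsetP F2E)-> //|_] /=.
  apply/negP => /andP[aE /imsetP[b /(subsetP F1E) bE ab]].
  by have := uv b a bE aE; rewrite ab eqxx.
Qed.

Lemma card_imsetU (T1 T2 T : finType) (u : T1 -> T) (v : T2 -> T)
    (E1 : {set T1}) (E2 : {set T2}) :
  injective u -> injective v ->
  {in E1 & E2, forall a b, u a != v b} ->
  #|u @: E1 :|: v @: E2| = (#|E1| + #|E2|)%N.
Proof.
move=> ui vi uv; rewrite cardsU !card_imset //.
suff -> : u @: E1 :&: v @: E2 = set0 by rewrite cards0 subn0.
apply/setP => t; rewrite !inE; apply/negP => /andP[/imsetP[a aE ->]].
by case/imsetP => b bE /eqP; rewrite (negbTE (uv a b aE bE)).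
Qed.

Lemma sum_exp_subsets (R : comNzRingType) (T : finType) (A : {set T}) (y : R) :
  \sum_(F : {set _} | F \subset A) y ^+ #|F| = (1 + y) ^+ #|A|.
Proof.
rewrite -[RHS]prodr_const [RHS]big_mkcond /=; apply: esym.
transitivity (\prod_(e : T) ((if e \in A then y else 0) + 1)).
  by apply: eq_bigr => e _; case: ifP; rewrite ?add0r // addrC.
rewrite bigA_distr [RHS]big_mkcond; apply: eq_bigr => F _ /=.
rewrite -big_mkcond /=; case: ifP => [/subsetP FA|/negbT/subsetPn[e eF /negbTE eA]].
  by rewrite -prodr_const; apply: eq_bigr => e /FA ->.
by rewrite (bigD1 e) //= eA mul0r.
Qed.

(** * The Fortuin-Kasteleyn and covering sums of a disjoint union *)

(** The union of a set of edges of [G] and a set of edges of [H], as a set of edges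
    of [gunion G H]. *)
Definition edges_sum (G H : sgraph) (E : {set {set G}}) (F : {set {set H}}) :
    {set {set gunion G H}} :=
  [set inl @: (e : {set G}) | e in E] :|: [set inr @: (e : {set H}) | e in F].

Lemma edges_gunion (G H : sgraph) : edges (gunion G H) = edges_sum (edges G) (edges H).
Proof. by []. Qed.

Lemma edge_neq0 (G : sgraph) (e : {set G}) : e \in edges G -> exists x, x \in e.
Proof. by move=> /edgesP[x [y [_ ->]]]; exists x; rewrite set21. Qed.

Lemma disjoint_edges (G H : sgraph) :
  {in edges G & edges H, forall (e : {set G}) (f : {set H}),
    (inl @: e : {set G + H}) != inr @: f}.
Proof.
move=> e f /edge_neq0[x xe] _; apply/eqP => /setP/(_ (inl x)).
by rewrite imset_f // => /esym/imsetP[].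
Qed.

Lemma card_edges_sum (G H : sgraph) (E : {set {set G}}) (F : {set {set H}}) :
  E \subset edges G -> F \subset edges H ->
  #|edges_sum E F| = (#|E| + #|F|)%N.
Proof.
move=> /subsetP EG /subsetP FH; apply: card_imsetU.
- exact/imset_inj/inl_inj.
- exact/imset_inj/inr_inj.
- by move=> e f /EG eG /FH fH; apply: disjoint_edges.
Qed.

Lemma sum_edges_gunion (R : nmodType) (G H : sgraph)
    (Phi : {set {set gunion G H}} -> R) :
  \sum_(F : {set _} | F \subset edges (gunion G H)) Phi F =
  \sum_(E : {set _} | E \subset edges G) \sum_(F : {set _} | F \subset edges H)
    Phi (edges_sum E F).
Proof.
apply: sum_subsets_imsetU; [exact/imset_inj/inl_inj|exact/imset_inj/inr_inj|].
exact: disjoint_edges.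
Qed.

Lemma spanning_edges_sum (G H : sgraph) (E : {set {set G}}) (F : {set {set H}}) :
  giso (gunion (spanning E) (spanning F)) (spanning (edges_sum E F)).
Proof.
have inlE (x y : G) : ([set inl x; inl y] \in edges_sum E F) = ([set x; y] \in E).
  rewrite inE -imset_pair mem_imset; last exact/imset_inj/inl_inj.
  apply/orb_idr => /imsetP[f _ /setP/(_ (inl x))].
  by rewrite imset_f ?set21 // => /esym/imsetP[].
have inrE (x y : H) : ([set inr x; inr y] \in edges_sum E F) = ([set x; y] \in F).
  rewrite inE orbC -imset_pair mem_imset; last exact/imset_inj/inr_inj.
  apply/orb_idr => /imsetP[f _ /setP/(_ (inr x))].
  by rewrite imset_f ?set21 // => /esym/imsetP[].
pose f (u : gunion (spanning E) (spanning F)) : spanning (edges_sum E F) := u.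
apply: (@giso_of_adj _ _ f); first by exists (fun u => u).
move=> u v; rewrite adj_spanning !adj_gunion.
by case: u v => x [] y; rewrite ?andbF ?adj_spanning // ?inlE ?inrE.
Qed.

Lemma connect_gunion (G H : sgraph) (u v : gunion G H) :
  connect (adj (gunion G H)) u v = match u, v with
    | inl x, inl y => connect (adj G) x y
    | inr x, inr y => connect (adj H) x y
    | _, _ => false
    end.
Proof.
apply/idP/idP; last first.
  case: u v => x [] y // xy.
  - apply: (connect_homo (e' := adj (gunion G H)) (f := inl) _ xy).
    by move=> a b; rewrite adj_gunion.
  - apply: (connect_homo (e' := adj (gunion G H)) (f := inr) _ xy).
    by move=> a b; rewrite adj_gunion.
case/connectP => p + ->; elim: p u => [|w p IH] u /=.
  by case: u => x _; apply: connect0.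
case/andP; rewrite adj_gunion; case: u w => x [] z //= xz /IH.
  by case: (last _ _) => // y; apply: connect_trans; apply: connect1.
by case: (last _ _) => // y; apply: connect_trans; apply: connect1.
Qed.

Lemma cc_gunion (G H : sgraph) : cc (gunion G H) = (cc G + cc H)%N.
Proof.
pose f (u : gunion G H) : quot (same_component G) + quot (same_component H) :=
  match u with inl x => inl (qpi _ x) | inr y => inr (qpi _ y) end.
rewrite (@cc_imset _ _ f) => [|u v]; last first.
  rewrite connect_gunion; case: u v => x [] y //=.
  - rewrite (inj_eq inl_inj) eq_qpi ?inE //.
    exact: same_component_equivalence.
  - rewrite (inj_eq inr_inj) eq_qpi ?inE //.
    exact: same_component_equivalence.
rewrite !cc_quot -card_sum -cardsT; congr #|pred_of_set _|.
apply/setP => -[] u; rewrite inE; have [x /eqP <-] := qpi_surj u.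
  by apply/imsetP; exists (inl x).
by apply/imsetP; exists (inr x).
Qed.

Lemma cc_edges_sum (G H : sgraph) (E : {set {set G}}) (F : {set {set H}}) :
  cc (spanning (edges_sum E F)) = (cc (spanning E) + cc (spanning F))%N.
Proof.
by rewrite -(cc_iso (spanning_edges_sum E F)) cc_gunion.
Qed.

(** The Fortuin-Kasteleyn polynomial at a point [a] of an arbitrary algebra. *)
Definition fk_eval (K : fieldType) (A : algType K) (y : K) (a : A) (G : sgraph) : A :=
  \sum_(F : {set {set G}} | F \subset edges G) y ^+ #|F| *: a ^+ cc (spanning F).

Lemma fk_eval_gunion (K : fieldType) (A : algType K) (y : K) (a : A) (G H : sgraph) :
  fk_eval y a (gunion G H) = fk_eval y a G * fk_eval y a H.
Proof.
rewrite /fk_eval sum_edges_gunion mulr_suml; apply: eq_bigr => E EG.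
rewrite mulr_sumr; apply: eq_bigr => F FH.
rewrite card_edges_sum // cc_edges_sum !exprD.
by rewrite -scalerAl -scalerAr scalerA.
Qed.

Lemma cc_leq_spanning (G : sgraph) (F : {set {set G}}) :
  (cc G <= cc (spanning F))%N.
Proof.
rewrite !cc_quot; apply: (leqif_card_quot _ _ _).1.
- exact: (same_component_equivalence (spanning F)).
- exact: same_component_equivalence.
apply/subsetP => -[x y]; rewrite !inE /=.
apply: (@connect_homo (spanning F) G (adj (spanning F)) (adj G) id) => u v.
by rewrite adj_spanning => /andP[].
Qed.

Lemma covering_edges_sum (G H : sgraph) (E : {set {set G}}) (F : {set {set H}}) :
  (cc (spanning (edges_sum E F)) == cc (gunion G H)) =
  (cc (spanning E) == cc G) && (cc (spanning F) == cc H).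
Proof.
rewrite cc_edges_sum cc_gunion eq_sym.
rewrite (leqif_add (leqif_eq (cc_leq_spanning E)) (leqif_eq (cc_leq_spanning F))).2.
by congr (_ && _); apply: eq_sym.
Qed.

Lemma covering_sum_gunion (R : comNzRingType) (y : R) (G H : sgraph) :
  \sum_(F in covering (gunion G H)) y ^+ #|F| =
  (\sum_(E in covering G) y ^+ #|E|) * (\sum_(F in covering H) y ^+ #|F|).
Proof.
have covE L : \sum_(F in covering L) y ^+ #|F| =
    \sum_(F : {set _} | F \subset edges L)
      if cc (spanning F) == cc L then y ^+ #|F| else 0.
  by rewrite -big_mkcondr; apply: eq_bigl => F; rewrite inE.
rewrite !covE sum_edges_gunion mulr_suml; apply: eq_bigr => E EG.
rewrite mulr_sumr; apply: eq_bigr => F FH.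
rewrite covering_edges_sum card_edges_sum // exprD.
by do 2![case: eqP => _]; rewrite ?mulr0 ?mul0r.
Qed.

(** * Empty graphs *)

Lemma edges_gempty : edges gempty = set0.
Proof. by []. Qed.

Lemma cc_eq0 (G : sgraph) : (cc G == 0%N) = (#|G| == 0%N).
Proof.
rewrite cc_quot -cardsT -imset_qpi; apply/eqP/eqP => [/eqP|G0].
  by rewrite cards_eq0 imset_eq0 -cards_eq0 cardsT => /eqP.
by apply/eqP; rewrite -leqn0 -G0 -[X in (_ <= X)%N]cardsT leq_imset_card.
Qed.

Lemma card0_edges (G : sgraph) : #|G| = 0%N -> edges G = set0.
Proof.
move=> G0; apply/setP => e; rewrite inE; apply/negP => /edge_neq0[x _].
by have := card0_eq G0 x; rewrite inE.
Qed.

Lemma sum_edges0 (R : nmodType) (G : sgraph) (Phi : {set {set G}} -> R) :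
  #|G| = 0%N -> \sum_(F : {set _} | F \subset edges G) Phi F = Phi set0.
Proof.
move=> G0; rewrite card0_edges // (big_pred1 set0) // => F.
by rewrite subset0.
Qed.

Lemma fk_eval0 (K : fieldType) (A : algType K) (y : K) (a : A) (G : sgraph) :
  #|G| = 0%N -> fk_eval y a G = 1.
Proof.
move=> G0; rewrite /fk_eval sum_edges0 // cards0 scale1r.
by have := cc_eq0 (@spanning G set0); rewrite G0 eqxx => /eqP ->.
Qed.

Lemma fk_eval_at0 (K : fieldType) (A : algType K) (y : K) (G : sgraph) :
  fk_eval y (0 : A) G = (#|G| == 0%N)%:R.
Proof.
case: eqP => [/fk_eval0 -> //|/eqP G0]; rewrite /fk_eval big1 // => F _.
by rewrite expr0n (cc_eq0 (spanning F)) (negbTE G0) scaler0.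
Qed.

(** * Unions of components and powers of a sum *)

Lemma exprD_subsets (R : comNzRingType) (T : finType) (a b : R) :
  (a + b) ^+ #|T| = \sum_(S : {set T}) a ^+ #|S| * b ^+ #|~: S|.
Proof.
rewrite -[LHS]prodr_const bigA_distr; apply: eq_bigr => S _.
rewrite (bigID (mem S)) /= -[a ^+ _]prodr_const -[b ^+ _]prodr_const.
congr (_ * _); first by apply: eq_bigr => i ->.
by apply: eq_big => i; rewrite ?inE // => /negbTE ->.
Qed.

Section Saturated.
Variable G : sgraph.

(** The projection of [G] onto its set of components. *)
Let pi : G -> quot (same_component G) := qpi (same_component G).

Let piE x y : (pi x == pi y) = connect (adj G) x y.
Proof. by rewrite /pi eq_qpi ?same_component_equivalence // inE. Qed.

Lemma saturated_preim (S : {set quot (same_component G)}) : saturated (pi @^-1: S).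
Proof.
apply/saturatedP => x y xy; rewrite !inE; suff -> : pi x = pi y by [].
by apply/eqP; rewrite piE connect1.
Qed.

Lemma preim_imset_saturated (I : {set G}) : saturated I -> pi @^-1: (pi @: I) = I.
Proof.
move=> /saturatedP sI; apply/setP => x; rewrite inE; apply/imsetP/idP => [[y yI]|xI].
  move=> /eqP; rewrite piE => xy.
  by rewrite (connect_eq_fun (f := fun z => z \in I) sI xy).
by exists x.
Qed.

Lemma cc_induced_preim (S : {set quot (same_component G)}) :
  cc (induced (pi @^-1: S)) = #|S|.
Proof.
rewrite (@cc_imset (induced _) _ (pi \o val)) => [|u v]; last first.
  by rewrite connect_induced ?saturated_preim // -piE.
apply: eq_card => u; apply/imsetP/idP => [[x _ ->]|].
  by have := valP x; rewrite inE.
have [x /eqP <-] := qpi_surj u => xS.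
have xI : x \in pi @^-1: S by rewrite inE.
by exists (exist _ x xI).
Qed.

(** Each component of [G] contributes a factor [a + b]; [I] is the union of those
    from which [a] is chosen. *)
Lemma exprD_cc (R : comNzRingType) (a b : R) :
  (a + b) ^+ cc G =
  \sum_(I : {set G} | saturated I) a ^+ cc (induced I) * b ^+ cc (induced (~: I)).
Proof.
rewrite cc_quot exprD_subsets.
rewrite [RHS](reindex_onto
  (fun S : {set _} => pi @^-1: S) (fun I : {set G} => pi @: I)) /=; last first.
  by move=> I /preim_imset_saturated.
apply: eq_big => [S|S _].
  rewrite saturated_preim; apply/esym/eqP/setP => u.
  apply/imsetP/idP => [[x + ->]|]; first by rewrite inE.
  by have [x /eqP <-] := qpi_surj u => xS; exists x; rewrite ?inE.
by rewrite -preimsetC !cc_induced_preim.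
Qed.

End Saturated.

(** * Compatibility with the coproduct *)

(** The edges of an induced subgraph, as edges of the whole graph. *)
Definition val_edges (G : sgraph) (I : {set G}) (F : {set {set induced I}}) :
    {set {set G}} :=
  [set val @: (e : {set {x | x \in I}}) | e in F].

(** The edges of [G] that do not join [I] to its complement. *)
Definition uncut (G : sgraph) (I : {set G}) : {set {set G}} :=
  [set e in edges G | (e \subset I) || (e \subset ~: I)].

Lemma saturated_spanning (G : sgraph) (I : {set G}) (F : {set {set G}}) :
  F \subset edges G -> @saturated (spanning F) I = (F \subset uncut I).
Proof.
move=> /subsetP FG; apply/saturatedP/subsetP => [sI e eF|sF x y].
  have [x [y [xy eE]]] := edgesP _ (FG e eF).
  have xyI : (x \in I) = (y \in I) by apply: sI; rewrite adj_spanning -eE eF.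
  rewrite inE FG // eE !subUset !sub1set !inE -xyI; by case: (x \in I).
rewrite adj_spanning => /andP[/sF].
rewrite inE !subUset !sub1set !inE => /andP[_].
by case: (x \in I) (y \in I) => [] [].
Qed.

Lemma mem_val_imset (T : finType) (I : {set T}) (e : {set {x | x \in I}}) :
  val @: e \subset I.
Proof. by apply/subsetP => _ /imsetP[x _ ->]; apply: valP. Qed.

Lemma val_imset_edges (G : sgraph) (I e : {set G}) :
  (e \in val_edges (edges (induced I))) = (e \in edges G) && (e \subset I).
Proof.
apply/imsetP/andP => [[f + ->]|[eG /subsetP eI]].
  by rewrite inE => ->; rewrite mem_val_imset.
have E : e = val @: (val @^-1: e : {set {x | x \in I}}).
  apply/setP => x; apply/idP/imsetP => [xe|[y + ->]]; last by rewrite inE.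
  by exists (exist _ x (eI x xe)); rewrite ?inE.
by exists (val @^-1: e); rewrite // inE -E.
Qed.

Lemma uncutE (G : sgraph) (I : {set G}) :
  uncut I = val_edges (edges (induced I)) :|: val_edges (edges (induced (~: I))).
Proof. by apply/setP => e; rewrite !inE !val_imset_edges andb_orr. Qed.

Lemma disjoint_val_edges (G : sgraph) (I J : {set G}) :
  [disjoint I & J] ->
  {in edges (induced I) & edges (induced J), forall (e : {set {x | x \in I}})
    (f : {set {x | x \in J}}), val @: e != val @: f}.
Proof.
move=> IJ e f /edge_neq0[x xe] _; apply/eqP => ef.
have /imsetP[z _ xz] : val x \in val @: f by rewrite -ef imset_f.
have := valP z; rewrite /= -xz => xJ.
by have := disjointFr IJ (valP x); rewrite xJ.
Qed.

Lemma cc_induced_spanning (G : sgraph) (I J : {set G})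
    (E : {set {set induced I}}) (F : {set {set induced J}}) :
  [disjoint I & J] ->
  cc (@induced (spanning (val_edges E :|: val_edges F)) I) = cc (spanning E).
Proof.
move=> IJ; apply/esym/cc_iso.
pose f (x : spanning E) : @induced (spanning (val_edges E :|: val_edges F)) I := x.
apply: (@giso_of_adj _ _ f) => [|x y]; first by exists (fun x => x).
rewrite adj_induced !adj_spanning adj_induced inE; congr (_ && _).
rewrite -imset_pair mem_imset; last exact/imset_inj/val_inj.
apply/orb_idr => /imsetP[e _ /setP/(_ (val x))].
rewrite imset_f ?set21 // => /esym/imsetP[z _ xz].
have := valP z; rewrite /= -xz => xJ.
by have := disjointFr IJ (valP x); rewrite xJ.
Qed.

Lemma fk_eval_coproduct (K : fieldType) (A : comAlgType K) (y : K) (a b : A)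
    (G : sgraph) :
  fk_eval y (a + b) G =
  \sum_(I : {set G}) fk_eval y a (induced I) * fk_eval y b (induced (~: I)).
Proof.
transitivity (\sum_(F : {set {set G}} | F \subset edges G)
    \sum_(I : {set G} | F \subset uncut I)
      y ^+ #|F| *: (a ^+ cc (@induced (spanning F) I)
                    * b ^+ cc (@induced (spanning F) (~: I)))).
  apply: eq_bigr => F FG; rewrite exprD_cc scaler_sumr.
  by apply: eq_bigl => I; apply: saturated_spanning.
rewrite (exchange_big_dep predT) //=; apply: eq_bigr => I _.
have IC : [disjoint I & ~: I] by rewrite -subsets_disjoint.
have CI : [disjoint ~: I & I] by rewrite disjoint_sym.
transitivity (\sum_(F : {set {set G}} | F \subset uncut I)
      y ^+ #|F| *: (a ^+ cc (@induced (spanning F) I)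
                    * b ^+ cc (@induced (spanning F) (~: I)))).
  apply: eq_bigl => F; rewrite andbC; apply: andb_idr => FI.
  apply: subset_trans FI _; apply/subsetP => e; rewrite inE => /andP[] //.
rewrite uncutE sum_subsets_imsetU; last first.
- exact: disjoint_val_edges.
- exact/imset_inj/val_inj.
- exact/imset_inj/val_inj.
rewrite [fk_eval y a _]/fk_eval mulr_suml; apply: eq_bigr => E EI.
rewrite mulr_sumr; apply: eq_bigr => F FI.
have cI := cc_induced_spanning E F IC; have := cc_induced_spanning F E CI.
rewrite setUC => cJ; rewrite -/(val_edges E) -/(val_edges F) cI cJ.
rewrite card_imsetU.
- by rewrite exprD -scalerAl -scalerAr scalerA.
- exact/imset_inj/val_inj.
- exact/imset_inj/val_inj.
- move=> e f /(subsetP EI) eI /(subsetP FI) fI; exact: disjoint_val_edges.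
Qed.

(** * The Hopf algebra morphism and the characters *)

Lemma zeta_graph (K : fieldType) (y : K) (G : sgraph) :
  zeta y << class G >> = fk_eval y 'X G.
Proof.
rewrite zeta_class horner_sum; apply: eq_bigr => F _.
by rewrite hornerM hornerC hornerXn -polyC_exp mulrC mul_polyC.
Qed.

Lemma linear_horner_alg (K : fieldType) (A : algType K) (a : A) :
  linear (horner_alg a).
Proof. by move=> c u v; rewrite linearP /= mulr_algl. Qed.

Lemma horner_alg_fk_eval (K : fieldType) (A : algType K) (y : K) (a : A) (G : sgraph) :
  horner_alg a (fk_eval y 'X G) = fk_eval y a G.
Proof.
rewrite linear_sum; apply: eq_bigr => F _.
by rewrite linearZ /= rmorphXn /= horner_algX mulr_algl.
Qed.

Lemma linear_zeta (K : fieldType) (y : K) : linear (zeta y).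
Proof. exact: lin_is_linear. Qed.

Lemma zeta_monoid_morphism (K : fieldType) (y : K) : monoid_morphism (zeta y).
Proof.
apply: monoid_morphism_graphs (@linear_zeta K y) (zeta_graph y) _ _ => [|G H].
  by apply: fk_eval0; apply: card_void.
exact: fk_eval_gunion.
Qed.

Lemma is_character_graphs (K : fieldType) (l : HG K -> K) (phi : sgraph -> K) :
  scalar l -> (forall G, l << class G >> = phi G) ->
  phi gempty = 1 -> (forall G H, phi (gunion G H) = phi G * phi H) ->
  is_character l.
Proof.
by move=> ll lE l1 lM; split; last exact: (@monoid_morphism_graphs K K^o l phi).
Qed.

Lemma lambda_character (K : fieldType) (y : K) : is_character (lambda y).
Proof.
apply: (is_character_graphs _ (fun G => lambda_class G y)) => [||G H].
- by move=> a u v; apply: (@lin_is_linear K K^o).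
- rewrite (big_pred1 set0) ?cards0 // => F.
  rewrite inE edges_gempty subset0; apply: andb_idr => _.
  have c0 (L : sgraph) : #|L| = 0%N -> cc L = 0%N.
    by move=> L0; apply/eqP; rewrite cc_eq0 L0.
  by rewrite !c0 ?card_void.
- exact: covering_sum_gunion.
Qed.

Lemma mu_character (K : fieldType) (y : K) : is_character (mu y).
Proof.
apply: (is_character_graphs _ (fun G => mu_class G y)) => [||G H].
- by move=> a u v; apply: (@lin_is_linear K K^o).
- by rewrite edges_gempty cards0.
- by rewrite edges_gunion card_edges_sum // exprD.
Qed.

Lemma lin_sum_basis (K : fieldType) (B : choiceType) (V : lmodType K) (f : B -> V)
    (I : finType) (P : pred I) (F : I -> B) :
  lin f (\sum_(i | P i) << F i >>) = \sum_(i | P i) f (F i).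
Proof.
have ll := lin_is_linear f.
rewrite (big_morph (lin f) (id1 := 0) (op1 := +%R)).
- by apply: eq_bigr => i _; apply: lin_basis.
- by move=> u v; rewrite -[u]scale1r ll !scale1r.
- exact: linear_fun0.
Qed.

Section Hopf.
Import mpoly.

Lemma zeta_Delta (K : fieldType) (y : K) x :
  poly_Delta (zeta y x) = tensor_square (zeta y) (Delta x).
Proof.
move: x; apply: eq_linear_graphs => [c u v|c u v|G].
- by rewrite linear_zeta; apply: linear_horner_alg.
- rewrite [Delta _]lin_is_linear; exact: lin_is_linear.
rewrite Delta_class zeta_graph /tensor_square lin_sum_basis.
rewrite [LHS]horner_alg_fk_eval fk_eval_coproduct; apply: eq_bigr => I _.
apply: esym; rewrite /poly_tensor /=.
congr (_ * _); apply: etrans (congr1 _ (zeta_graph _ _)) _;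
exact: horner_alg_fk_eval.
Qed.

End Hopf.

Lemma zeta_eps (K : fieldType) (y : K) x : poly_eps (zeta y x) = eps_Delta x.
Proof.
move: x; apply: (@eq_linear_graphs K K^o) => [c u v|c u v|G].
- by rewrite linear_zeta /poly_eps hornerD hornerZ.
- exact: (@lin_is_linear K K^o).
rewrite eps_Delta_class zeta_graph /poly_eps.
rewrite horner_sum -(@fk_eval_at0 K K^o y); apply: eq_bigr => F _.
by rewrite hornerZ hornerXn.
Qed.

(** * The action of the characters *)

Lemma act_class (K : fieldType) (phi : HG K -> {poly K}) (l : HG K -> K) (G : sgraph) :
  act phi l << class G >> =
  \sum_(r in Ec G) l << class (restrict r) >> *: phi << class (contract r) >>.
Proof. by rewrite /act delta_class /delta_graph lin_sum_basis. Qed.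

Lemma linear_act (K : fieldType) (phi : HG K -> {poly K}) (l : HG K -> K) :
  linear (act phi l).
Proof. move=> c u v; rewrite /act [delta _]lin_is_linear; exact: lin_is_linear. Qed.

Lemma zeta_act_phi0 (K : fieldType) (y : K) : zeta y =1 act (@phi0 K) (lambda y).
Proof.
apply: eq_linear_graphs => [||G]; [exact: linear_zeta|exact: linear_act|].
rewrite zeta_graph act_class /fk_eval.
rewrite (partition_big
  (fun F : {set {set G}} => same_component (spanning F) : {set G * G})
  (mem (Ec G))) /=; last first.
  by move=> F _; apply: same_component_spanning_Ec.
apply: eq_bigr => r rEc; rewrite lambda_class phi0_class scaler_suml.
apply: eq_big => F; first exact/esym/(covering_restrict F rEc).
by move=> /andP[_ /eqP rE]; rewrite cc_quot rE.
Qed.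

(** * Sums over colourings *)

(** The monochromatic edges of a colouring. *)
Definition mono_edges (G : sgraph) (k : nat) (f : {ffun G -> 'I_k}) : {set {set G}} :=
  [set e in edges G | [forall x in e, forall y in e, f x == f y]].

Section Potts.
Variables (G : sgraph) (k : nat).
Implicit Types (f : {ffun G -> 'I_k}) (F : {set {set G}}).

Lemma adj_mono f x y : adj (spanning (mono_edges f)) x y = adj G x y && (f x == f y).
Proof.
rewrite adj_spanning inE -/(adj G x y) andbC andbA andbb; congr (_ && _).
apply/forall_inP/eqP => [P|fxy z].
  by have /forall_inP/(_ y) := P x (set21 _ _); rewrite set22 => /(_ isT)/eqP.
rewrite !inE => zE; apply/forall_inP => t; rewrite !inE.
by case/orP: zE => /eqP ->; case/orP => /eqP ->; rewrite ?fxy.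
Qed.

Lemma sub_mono_edges f F : F \subset edges G ->
  (F \subset mono_edges f) =
  [forall x : G, forall y : G, adj (spanning F) x y ==> (f x == f y)].
Proof.
move=> /subsetP FG; apply/subsetP/forallP => [FM x|P e eF].
  apply/forallP => y; apply/implyP; rewrite adj_spanning => /andP[/FM].
  rewrite inE => /andP[_ /forall_inP/(_ x (set21 _ _))/forall_inP/(_ y)].
  by rewrite set22 => /(_ isT).
have eG := FG e eF; have [x [y [xy eE]]] := edgesP _ eG.
have /forallP/(_ y)/implyP := P x; rewrite adj_spanning -eE eF xy => /(_ isT) fxy.
have : adj (spanning (mono_edges f)) x y by rewrite adj_mono xy.
by rewrite adj_spanning -eE => /andP[].
Qed.

(** The Potts model form of the Fortuin-Kasteleyn polynomial. *)
Lemma fk_eval_nat (K : fieldType) (y : K) :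
  (fk_eval y 'X G).[k%:R] = \sum_(f : {ffun G -> 'I_k}) (1 + y) ^+ #|mono_edges f|.
Proof.
rewrite horner_sum.
transitivity (\sum_(F : {set {set G}} | F \subset edges G)
    \sum_(f : {ffun G -> 'I_k} | F \subset mono_edges f) y ^+ #|F|).
  apply: eq_bigr => F FG; rewrite hornerZ hornerXn -natrX.
  rewrite -card_constant_on_components sumr_const mulr_natr; congr (_ *+ _).
  by apply: eq_card => f; rewrite inE -sub_mono_edges.
rewrite (exchange_big_dep predT) //=; apply: eq_bigr => f _.
rewrite -sum_exp_subsets; apply: eq_bigl => F; apply: andb_idl => FM.
by apply: subset_trans FM _; apply/subsetP => e; rewrite inE => /andP[].
Qed.

Lemma mono_edges_restrict f (r : {set G * G}) : r \in Ec G ->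
  same_component (spanning (mono_edges f)) = r -> mono_edges f = edges (restrict r).
Proof.
move=> rEc fr; have rE : is_equivalence r by move: rEc; rewrite inE => /andP[].
have MG : mono_edges f \subset edges G by apply/subsetP => e; rewrite inE => /andP[].
apply/eqP; rewrite eqEsubset sub_edges_restrict // fr subxx /=.
rewrite sub_mono_edges ?edges_restrict //.
apply/forallP => x; apply/forallP => y; apply/implyP.
rewrite adj_spanning => /andP[xy _]; move: (xy : adj (restrict r) x y).
rewrite adj_restrict eq_qpi // => /andP[_].
rewrite -fr inE /= => cxy; apply/eqP; apply: connect_eq_fun cxy => u v.
by rewrite adj_mono => /andP[_ /eqP].
Qed.

(** A proper colouring [g] of [contract r] gives the colouring [x |-> g (qpi r x)]
    of [G]; its monochromatic edges are those of [restrict r], so its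
    monochromatic graph has the classes of [r] as components. *)
Lemma card_proper_contract (r : {set G * G}) : r \in Ec G ->
  #|proper_colorings (contract r) k| =
  #|[set f : {ffun G -> 'I_k} | same_component (spanning (mono_edges f)) == r]|.
Proof.
move=> rEc; have rE : is_equivalence r by move: rEc; rewrite inE => /andP[].
pose h (g : {ffun contract r -> 'I_k}) : {ffun G -> 'I_k} := [ffun x => g (qpi r x)].
have h_inj : injective h.
  move=> g g' /ffunP gg'; apply/ffunP => u; have [x /eqP <-] := qpi_surj u.
  by have := gg' x; rewrite !ffunE.
rewrite -(card_imset _ h_inj); apply: eq_card => f; rewrite inE.
apply/imsetP/eqP => [[g]|fr].
  rewrite inE => /forallP gP ->; rewrite -[RHS](same_component_restrict rEc).
  apply/setP => p; rewrite !inE; apply: eq_connect => x y.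
  rewrite adj_mono adj_restrict !ffunE; case xy: (adj G x y) => //=.
  apply/eqP/eqP => [gxy|-> //]; apply/eqP/negPn/negP => nxy.
  have /forallP/(_ (qpi r y))/implyP := gP (qpi r x); rewrite gxy eqxx => /(_ _)/negP.
  case=> //; rewrite adj_contract nxy; apply/existsP; exists (x, y).
  by rewrite /= xy !eqxx.
pose s (u : contract r) : G := xchoose (qpi_surj u).
have fs x : f (s (qpi r x)) = f x.
  have : (s (qpi r x), x) \in same_component (spanning (mono_edges f)).
    by rewrite fr -eq_qpi //; apply: (xchooseP (qpi_surj (qpi r x))).
  rewrite inE /=.
  by apply: connect_eq_fun => u v; rewrite adj_mono => /andP[_ /eqP].
exists [ffun u => f (s u)]; last by apply/ffunP => x; rewrite !ffunE fs.
rewrite inE; apply/forallP => u; apply/forallP => v; apply/implyP; rewrite !ffunE.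
rewrite adj_contract => /andP[uv /existsP[[x y] /= /and3P[xy /eqP xu /eqP yv]]].
move: uv; rewrite -xu -yv !fs; apply: contra => fxy.
by rewrite eq_qpi // -fr inE /= connect1 // adj_mono xy.
Qed.

End Potts.

Lemma eq_poly_nat (K : fieldType) (p q : {poly K}) :
  [pchar K] =i pred0 -> (forall k : nat, p.[k%:R] = q.[k%:R]) -> p = q.
Proof.
move=> K0 pq.
(* Adding [p - q] to a chromatic polynomial does not change its values at the
   natural numbers, which determine it. *)
apply/eqP; rewrite -subr_eq0 -(inj_eq (addIr (chromatic gempty K))) add0r.
apply/eqP/chromatic_unique => // k.
by rewrite !hornerD hornerN pq subrr add0r chromaticE.
Qed.

Lemma zeta_act_phi_chr (K : fieldType) (y : K) : [pchar K] =i pred0 ->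
  zeta y =1 act (@phi_chr K) (mu y).
Proof.
move=> K0; apply: eq_linear_graphs => [||G]; [exact: linear_zeta|exact: linear_act|].
rewrite zeta_graph act_class; apply: eq_poly_nat => // k.
rewrite fk_eval_nat horner_sum.
rewrite (partition_big
  (fun f : {ffun G -> 'I_k} => same_component (spanning (mono_edges f)) : {set G * G})
  (mem (Ec G))) /=;
  last by move=> f _; apply: same_component_spanning_Ec.
apply: eq_bigr => r rEc; rewrite mu_class phi_chr_class // hornerZ chromaticE.
rewrite card_proper_contract // mulr_natr -sumr_const; apply: eq_big => f.
  by rewrite inE.
by move=> /eqP fr; rewrite (mono_edges_restrict rEc fr).
Qed.

Theorem theorem2p13 (K : fieldType) (charK : [pchar K] =i pred0) (y : K) :
  [/\ hopf_morphism (zeta y),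
      is_character (lambda y),
      is_character (mu y),
      zeta y =1 act (@phi0 K) (lambda y)
    & zeta y =1 act (@phi_chr K) (mu y)].
Proof.
split.
- split; first exact: linear_zeta.
  + exact: zeta_monoid_morphism.
  + exact: zeta_Delta.
  + exact: zeta_eps.
- exact: lambda_character.
- exact: mu_character.
- exact: zeta_act_phi0.
- exact: zeta_act_phi_chr.
Qed.
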